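(* Let $(R,m_R)$ be a Noetherian local ring of dimension $d$ and let $I_1,\dots,I_r,J_1,\dots,J_r$ be ideals of $R$ such that $I_i\subseteq J_i$ and $l_R(J_i/I_i)<\infty$ for all $i=1,\dots,r$. Then there exists a numerical polynomial $F\in\mathbb{Q}[n_1,\dots,n_r]$ of total degree at most $d$ such that $$l_R\left(\frac{J_1^{n_1}\cdots J_r^{n_r}}{I_1^{n_1}\cdots I_r^{n_r}}\right)=F(n_1,\dots,n_r)$$ for all $n_1,\dots,n_r\gg0$.
   Context: A numerical polynomial is a polynomial with rational coefficients taking integer values at integer points; $l_R$ denotes length. *)

(* Defs.v *)
From HB Require Import structures.
From mathcomp Require Import all_boot all_order all_algebra.
From mathcomp Require Import mpoly.
Set Implicit Arguments. Unset Strict Implicit. Unset Printing Implicit Defensive.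
Import Order.TTheory GRing.Theory Num.Theory.
Local Open Scope ring_scope.

Section CommAlg.
Variable R : comNzRingType.

Definition is_ideal (I : R -> Prop) : Prop :=
  I 0 /\ (forall x y, I x -> I y -> I (x + y)) /\ (forall a x, I x -> I (a * x)).

Definition sub_ideal (I J : R -> Prop) : Prop := forall x, I x -> J x.
Definition strict_sub (I J : R -> Prop) : Prop := sub_ideal I J /\ ~ sub_ideal J I.

Definition prime_ideal (P : R -> Prop) : Prop :=
  is_ideal P /\ ~ P 1 /\ (forall x y, P (x * y) -> P x \/ P y).

Definition maximal_ideal (M : R -> Prop) : Prop :=
  is_ideal M /\ ~ M 1 /\
  (forall J, is_ideal J -> sub_ideal M J -> J 1 \/ sub_ideal J M).

Definition local_ring : Prop :=
  exists m, maximal_ideal m /\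
    forall M, maximal_ideal M -> (forall x, M x <-> m x).

Definition noetherian : Prop :=
  forall I : nat -> R -> Prop,
    (forall n, is_ideal (I n)) -> (forall n, sub_ideal (I n) (I n.+1)) ->
    exists N, forall n, (N <= n)%N -> sub_ideal (I n) (I N).

Definition has_prime_chain (k : nat) : Prop :=
  exists P : nat -> R -> Prop,
    (forall i, (i <= k)%N -> prime_ideal (P i)) /\
    (forall i, (i < k)%N -> strict_sub (P i) (P i.+1)).

Definition krull_dim (d : nat) : Prop := has_prime_chain d /\ ~ has_prime_chain d.+1.

(* Length of the R-module J/I (I ⊆ J ideals): submodules of J/I correspond
   to ideals K with I ⊆ K ⊆ J; l_R(J/I) is the supremum of lengths of strict
   chains of such submodules. *)
Definition has_chain_between (I J : R -> Prop) (k : nat) : Prop :=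
  exists K : nat -> R -> Prop,
    (forall i, (i <= k)%N -> is_ideal (K i) /\ sub_ideal I (K i) /\ sub_ideal (K i) J) /\
    (forall i, (i < k)%N -> strict_sub (K i) (K i.+1)).

Definition length_eq (I J : R -> Prop) (l : nat) : Prop :=
  has_chain_between I J l /\ ~ has_chain_between I J l.+1.

Definition ideal_mul (I J : R -> Prop) : R -> Prop :=
  fun x => exists n (a b : 'I_n -> R),
    (forall i, I (a i)) /\ (forall i, J (b i)) /\ x = \sum_(i < n) a i * b i.

Definition unit_ideal : R -> Prop := fun _ => True.

Definition ideal_exp (I : R -> Prop) (n : nat) : R -> Prop :=
  iter n (ideal_mul I) unit_ideal.

Definition ideal_prod_exp (r : nat) (I : 'I_r -> R -> Prop) (n : 'I_r -> nat) : R -> Prop :=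
  foldr (fun i acc => ideal_mul (ideal_exp (I i) (n i)) acc) unit_ideal (enum 'I_r).

End CommAlg.

Definition numerical_poly (r : nat) (F : {mpoly rat[r]}) : Prop :=
  forall z : 'I_r -> int, F.@[fun i => (z i)%:~R] \is a Num.int.

(* Main.v *)
Require Import Defs.
From HB Require Import structures.
From mathcomp Require Import all_boot all_order all_algebra.
From mathcomp Require Import mpoly ring zify.
From Stdlib Require Import Classical ClassicalEpsilon FunctionalExtensionality.
From Stdlib Require Import PropExtensionality.
Import Order.TTheory GRing.Theory Num.Theory.
Local Open Scope ring_scope.
Set Implicit Arguments. Unset Strict Implicit. Unset Printing Implicit Defensive.

(** Work with exponent vectors of monomials in generators of the ideals instead of
    multi-Rees algebras. Let [z] run through generators of the [J_i] and [y] through generators of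
    the [I_i], and order monomials lexicographically with the [z] first. Then [J^n / I^n] is
    filtered by the monomials [mu] of multidegree [n] involving some [z], with successive quotients
    [R / L_mu], where [L_mu] consists of the [c] such that [c mu] is a combination of smaller
    monomials of the same multidegree. Some power of the maximal ideal [m] lies in [L_mu], so
    [R / L_mu] has finite length. Since [L_mu] increases with [mu] and [R] is Noetherian, [L_mu]
    only depends on [mu] truncated at some bound [c]; hence the length of [J^n / I^n] is a sum of
    products of eventually polynomial functions of the single [n_i].

    These products take nonnegative values, so each has degree at most [d] as soon as the length
    is [O(s^d)] on the diagonal [n = (s, .., s)]. Put [A = J_1 .. J_r]. The same stability of
    leading coefficient ideals gives the linear Artin-Rees inclusion of
    [m^N] intersected with [A^s] in [m^(N - k s) A^s], whence [m^(c s)] intersected with [J^n] lies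
    in [I^n] for some [c], and the length is at most that of [R / m^(c s)], which is [O(s^d)]
    because [R] has a parameter ideal with [d] generators. *)

(** * Ideals *)

Section Ideals.
Variable R : comNzRingType.
Implicit Types (A B C I J K M S : R -> Prop) (a b c x y : R).

Lemma sub_ideal_antisym A B : sub_ideal A B -> sub_ideal B A -> A = B.
Proof.
move=> AB BA; apply: functional_extensionality => x.
by apply: propositional_extensionality; split; [apply: AB | apply: BA].
Qed.

Lemma sub_ideal_refl A : sub_ideal A A. Proof. by []. Qed.

Lemma sub_ideal_trans A B C : sub_ideal A B -> sub_ideal B C -> sub_ideal A C.
Proof. by move=> AB BC x /AB /BC. Qed.

Lemma not_sub_ideal A B : ~ sub_ideal A B -> exists x, A x /\ ~ B x.
Proof.
move=> nAB; apply: NNPP => h; apply: nAB => x Ax.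
by apply: NNPP => nBx; apply: h; exists x.
Qed.

Lemma ideal0 A : is_ideal A -> A 0. Proof. by case. Qed.

Lemma idealD A x y : is_ideal A -> A x -> A y -> A (x + y).
Proof. by move=> [_ [h _]]; apply: h. Qed.

Lemma ideal_absorbl A a x : is_ideal A -> A x -> A (a * x).
Proof. by move=> [_ [_ h]]; apply: h. Qed.

Lemma ideal_absorbr A a x : is_ideal A -> A x -> A (x * a).
Proof. by move=> ?; rewrite mulrC; apply: ideal_absorbl. Qed.

Lemma idealN A x : is_ideal A -> A x -> A (- x).
Proof. by move=> ?; rewrite -mulN1r; apply: ideal_absorbl. Qed.

Lemma idealB A x y : is_ideal A -> A x -> A y -> A (x - y).
Proof. by move=> ? ? ?; apply: idealD => //; apply: idealN. Qed.

Lemma unit_is_ideal : is_ideal (@unit_ideal R). Proof. by []. Qed.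

Lemma ideal1 A x : is_ideal A -> A 1 -> A x.
Proof. by move=> iA A1; rewrite -[x]mulr1; apply: ideal_absorbl. Qed.

(** Linear combinations grow one term at a time, so statements about spans go by induction instead
    of through indexed sums. *)
Inductive ideal_span S : R -> Prop :=
| span0 : ideal_span S 0
| spanMD a x y : S x -> ideal_span S y -> ideal_span S (a * x + y).

Lemma span_is_ideal S : is_ideal (ideal_span S).
Proof.
split; [exact: span0 | split].
- move=> x y + Sy; elim=> [|a u v Su _ IH]; first by rewrite add0r.
  by rewrite -addrA; apply: spanMD.
- move=> c x; elim=> [|a u v Su _ IH]; first by rewrite mulr0; apply: span0.
  by rewrite mulrDr mulrA; apply: spanMD.
Qed.

Lemma mem_span S x : S x -> ideal_span S x.
Proof.
by move=> Sx; rewrite -[x]mul1r -[_ * _]addr0; apply: spanMD => //; apply: span0.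
Qed.

Lemma span_min S K : is_ideal K -> (forall x, S x -> K x) -> sub_ideal (ideal_span S) K.
Proof.
move=> iK SK x; elim=> [|a u v Su _ IH]; first exact: ideal0.
by apply: idealD => //; apply: ideal_absorbl => //; apply: SK.
Qed.

Lemma span_sub S S' : (forall x, S x -> S' x) -> sub_ideal (ideal_span S) (ideal_span S').
Proof.
by move=> SS; apply: span_min; [apply: span_is_ideal | move=> x /SS; apply: mem_span].
Qed.

Lemma span_mulr S K c x : is_ideal K -> (forall x, S x -> K (c * x)) ->
  ideal_span S x -> K (c * x).
Proof.
move=> iK SK; elim=> [|a u v Su _ IH]; first by rewrite mulr0; apply: ideal0.
by rewrite mulrDr mulrCA; apply: idealD => //; apply: ideal_absorbl => //; apply: SK.
Qed.

(** Trades indexed sums for spans; a coefficient of the span is absorbed into the factor from [A],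
    which is where [is_ideal A] enters. *)
Lemma ideal_mulE A B : is_ideal A ->
  ideal_mul A B = ideal_span (fun x => exists a b, A a /\ B b /\ x = a * b).
Proof.
move=> iA; apply: sub_ideal_antisym => x.
- case=> n [a [b [Aa [Bb ->]]]].
  elim/big_ind: _ => [|u v|i _].
  + exact: span0.
  + by move=> *; apply: idealD => //; apply: span_is_ideal.
  + by apply: mem_span; exists (a i), (b i).
- elim=> [|c u v [a [b [Aa [Bb ->]]]] _ [n [f [g [Af [Bg ->]]]]]].
    by exists 0%N, (fun=> 0), (fun=> 0); split; [case|split; [case|rewrite big_ord0]].
  exists n.+1, (fun i => oapp f (c * a) (unlift ord0 i)),
         (fun i => oapp g b (unlift ord0 i)).
  split; first by move=> i; case: unliftP => [j _|_] /=; [apply: Af|apply: ideal_absorbl].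
  split; first by move=> i; case: unliftP => [j _|_] /=; [apply: Bg|].
  rewrite big_ord_recl /= !unlift_none /= mulrA; congr (_ + _).
  by apply: eq_bigr => i _; rewrite !liftK.
Qed.

Lemma mul_is_ideal A B : is_ideal A -> is_ideal (ideal_mul A B).
Proof. by move=> iA; rewrite ideal_mulE //; apply: span_is_ideal. Qed.

Lemma mem_mul A B a b : A a -> B b -> ideal_mul A B (a * b).
Proof.
move=> Aa Bb; exists 1%N, (fun=> a), (fun=> b).
by split=> //; split=> //; rewrite big_ord1.
Qed.

Lemma mul_min A B K : is_ideal K ->
  (forall a b, A a -> B b -> K (a * b)) -> sub_ideal (ideal_mul A B) K.
Proof.
move=> iK h x [n [a [b [Aa [Bb ->]]]]]; elim/big_ind: _ => [|u v|i _].
- exact: ideal0.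
- exact: idealD.
- exact: h.
Qed.

Lemma mul_sub A B A' B' : sub_ideal A A' -> sub_ideal B B' ->
  sub_ideal (ideal_mul A B) (ideal_mul A' B').
Proof.
move=> AA BB x [n [a [b [Aa [Bb ->]]]]]; exists n, a, b.
by split; [move=> i; apply: AA | split=> // i; apply: BB].
Qed.

Lemma mul_subl A B : is_ideal A -> sub_ideal (ideal_mul A B) A.
Proof. by move=> iA; apply: mul_min => // a b Aa _; apply: ideal_absorbr. Qed.

Lemma mul_subr A B : is_ideal B -> sub_ideal (ideal_mul A B) B.
Proof. by move=> iA; apply: mul_min => // a b _; apply: ideal_absorbl. Qed.

Lemma ideal_mulC A B : ideal_mul A B = ideal_mul B A.
Proof.
apply: sub_ideal_antisym => x [n [a [b [Aa [Bb ->]]]]]; exists n, b, a;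
  do 2![split=> //]; by apply: eq_bigr => i _; rewrite mulrC.
Qed.

Lemma ideal_mulA A B C : is_ideal A -> is_ideal B -> is_ideal C ->
  ideal_mul A (ideal_mul B C) = ideal_mul (ideal_mul A B) C.
Proof.
move=> iA iB iC; have iAB := mul_is_ideal B iA; have iBC := mul_is_ideal C iB.
apply: sub_ideal_antisym.
- apply: mul_min; first exact: mul_is_ideal.
  move=> a x Aa; rewrite ideal_mulE //; apply: span_mulr; first exact: mul_is_ideal.
  by move=> _ [b [c [Bb [Cc ->]]]]; rewrite mulrA; do 2?apply: mem_mul.
- apply: mul_min; first exact: mul_is_ideal.
  move=> x c + Cc; rewrite (ideal_mulE _ iA) mulrC; apply: span_mulr; first exact: mul_is_ideal.
  by move=> _ [b [d [Bb [Dd ->]]]]; rewrite mulrC -mulrA; do 2?apply: mem_mul.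
Qed.

Lemma ideal_mul1l A : is_ideal A -> ideal_mul (@unit_ideal R) A = A.
Proof.
move=> iA; apply: sub_ideal_antisym; first exact: mul_subr.
by move=> x Ax; rewrite -[x]mul1r; apply: mem_mul.
Qed.

Lemma ideal_mulACA A B C D : is_ideal A -> is_ideal B -> is_ideal C -> is_ideal D ->
  ideal_mul (ideal_mul A B) (ideal_mul C D) = ideal_mul (ideal_mul A C) (ideal_mul B D).
Proof.
move=> iA iB iC iD; rewrite -!ideal_mulA //; try exact: mul_is_ideal.
by rewrite (ideal_mulA iB) // (ideal_mulC B) -(ideal_mulA iC).
Qed.

Lemma exp_is_ideal A n : is_ideal A -> is_ideal (ideal_exp A n).
Proof. by move=> iA; case: n => [|n] //; apply: mul_is_ideal. Qed.

Lemma ideal_expS A n : ideal_exp A n.+1 = ideal_mul A (ideal_exp A n).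
Proof. by []. Qed.

Lemma ideal_expD A m n : is_ideal A ->
  ideal_exp A (m + n) = ideal_mul (ideal_exp A m) (ideal_exp A n).
Proof.
move=> iA; elim: m => [|m IH]; first by rewrite ideal_mul1l //; apply: exp_is_ideal.
by rewrite addSn !ideal_expS IH ideal_mulA //; apply: exp_is_ideal.
Qed.

Lemma ideal_expMn A B n : is_ideal A -> is_ideal B ->
  ideal_exp (ideal_mul A B) n = ideal_mul (ideal_exp A n) (ideal_exp B n).
Proof.
move=> iA iB; elim: n => [|n IH]; first by rewrite ideal_mul1l.
by rewrite !ideal_expS IH ideal_mulACA //; apply: exp_is_ideal.
Qed.

Lemma ideal_expM A m n : is_ideal A -> ideal_exp A (m * n) = ideal_exp (ideal_exp A m) n.
Proof.
move=> iA; elim: n => [|n IH]; first by rewrite muln0.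
by rewrite mulnS ideal_expD // IH.
Qed.

Lemma ideal_exp_unit n : ideal_exp (@unit_ideal R) n = @unit_ideal R.
Proof. by elim: n => // n IH; rewrite ideal_expS IH ideal_mul1l. Qed.

Lemma exp_sub A B n : sub_ideal A B -> sub_ideal (ideal_exp A n) (ideal_exp B n).
Proof. by move=> AB; elim: n => // n IH; apply: mul_sub. Qed.

Lemma exp_anti A m n : is_ideal A -> (m <= n)%N ->
  sub_ideal (ideal_exp A n) (ideal_exp A m).
Proof.
move=> iA /subnKC <-; rewrite ideal_expD //; apply: mul_subl.
exact: exp_is_ideal.
Qed.

Lemma mem_exp A x n : A x -> ideal_exp A n (x ^+ n).
Proof. by move=> Ax; elim: n => // n IH; rewrite exprS; apply: mem_mul. Qed.

(** On the diagonal the multi-indexed products become powers of one ideal, the setting of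
    Artin-Rees. *)
Lemma prod_exp_const r (A : 'I_r -> R -> Prop) s : (forall i, is_ideal (A i)) ->
  ideal_prod_exp A (fun=> s) = ideal_exp (ideal_prod_exp A (fun=> 1%N)) s.
Proof.
move=> iA; rewrite /ideal_prod_exp; set t := enum _.
suff [_ ->] : is_ideal (foldr (fun i acc => ideal_mul (ideal_exp (A i) 1) acc)
    (@unit_ideal R) t) /\ foldr (fun i acc => ideal_mul (ideal_exp (A i) s) acc)
    (@unit_ideal R) t = ideal_exp (foldr (fun i acc => ideal_mul (ideal_exp (A i) 1) acc)
    (@unit_ideal R) t) s by [].
elim: t => [|i t [IH1 IH2]] /=; first by rewrite ideal_exp_unit.
rewrite [ideal_mul (A i) _]ideal_mulC ideal_mul1l //.
by split; [apply: mul_is_ideal | rewrite IH2 ideal_expMn].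
Qed.

Definition ideal_add A B : R -> Prop := fun x => exists a b, A a /\ B b /\ x = a + b.
Definition ideal_cap A B : R -> Prop := fun x => A x /\ B x.
Definition principal a : R -> Prop := fun x => exists c, x = c * a.
Definition colon B a : R -> Prop := fun c => B (c * a).

Lemma add_is_ideal A B : is_ideal A -> is_ideal B -> is_ideal (ideal_add A B).
Proof.
move=> iA iB; split; first by exists 0, 0; rewrite addr0; do 2?[split; try exact: ideal0].
split.
- move=> _ _ [a [b [Aa [Bb ->]]]] [a' [b' [Aa' [Bb' ->]]]].
  by exists (a + a'), (b + b'); rewrite addrACA; do 2?[split; try exact: idealD].
- move=> c _ [a [b [Aa [Bb ->]]]]; exists (c * a), (c * b).
  by rewrite mulrDr; do 2?[split; try exact: ideal_absorbl].
Qed.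

Lemma cap_is_ideal A B : is_ideal A -> is_ideal B -> is_ideal (ideal_cap A B).
Proof.
move=> iA iB; split; first by split; apply: ideal0.
split; first by move=> x y [? ?] [? ?]; split; apply: idealD.
by move=> c x [? ?]; split; apply: ideal_absorbl.
Qed.

Lemma principal_is_ideal a : is_ideal (principal a).
Proof.
split; first by exists 0; rewrite mul0r.
split; first by move=> _ _ [c ->] [d ->]; exists (c + d); rewrite mulrDl.
by move=> c _ [d ->]; exists (c * d); rewrite mulrA.
Qed.

Lemma colon_is_ideal B a : is_ideal B -> is_ideal (colon B a).
Proof.
move=> iB; rewrite /colon; split; first by rewrite mul0r; apply: ideal0.
split; first by move=> x y ? ?; rewrite mulrDl; apply: idealD.
by move=> c x ?; rewrite -mulrA; apply: ideal_absorbl.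
Qed.

Lemma add_subl A B : is_ideal B -> sub_ideal A (ideal_add A B).
Proof. by move=> iB x Ax; exists x, 0; rewrite addr0; do 2?split=> //; apply: ideal0. Qed.

Lemma add_subr A B : is_ideal A -> sub_ideal B (ideal_add A B).
Proof. by move=> iB x Ax; exists 0, x; rewrite add0r; do 2?split=> //; apply: ideal0. Qed.

Lemma add_min A B K : is_ideal K -> sub_ideal A K -> sub_ideal B K ->
  sub_ideal (ideal_add A B) K.
Proof. by move=> iK AK BK _ [a [b [/AK ? [/BK ? ->]]]]; apply: idealD. Qed.

Lemma add_principal_min A a K : is_ideal K -> sub_ideal A K -> K a ->
  sub_ideal (ideal_add A (principal a)) K.
Proof. by move=> iK AK Ka; apply: add_min => // _ [c ->]; apply: ideal_absorbl. Qed.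

Lemma mem_add_principal A a : is_ideal A -> ideal_add A (principal a) a.
Proof. by move=> iA; apply: add_subr => //; exists 1; rewrite mul1r. Qed.

Lemma add_principal_is_ideal A a : is_ideal A -> is_ideal (ideal_add A (principal a)).
Proof. by move=> iA; apply: add_is_ideal => //; apply: principal_is_ideal. Qed.

Lemma strict_add_principal A a : is_ideal A -> ~ A a ->
  strict_sub A (ideal_add A (principal a)).
Proof.
move=> iA nAa; split; first exact/add_subl/principal_is_ideal.
by move/(_ a (mem_add_principal a iA)).
Qed.

End Ideals.

#[local] Hint Resolve sub_ideal_refl unit_is_ideal span_is_ideal mul_is_ideal exp_is_ideal
  add_is_ideal cap_is_ideal principal_is_ideal colon_is_ideal : core.

(** * Length *)

Section Length.
Variable R : comNzRingType.
Implicit Types (A B C I J K M S : R -> Prop) (a b c x y : R) (k l : nat).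

Lemma chainS I J K K' k : is_ideal K -> is_ideal K' -> sub_ideal I K ->
  has_chain_between I K k -> strict_sub K K' -> sub_ideal K' J ->
  has_chain_between I J k.+1.
Proof.
move=> iK iK' IK [C [hC sC]] KK' K'J.
have KJ : sub_ideal K J by apply: sub_ideal_trans K'J; case: KK'.
have IK' : sub_ideal I K' by apply: sub_ideal_trans IK _; case: KK'.
exists (fun i => if (i <= k)%N then C i else K'); split=> i.
- case: (leqP i k) => [/hC [? [? CK]] _|_ _]; last by [].
  by do 2?split=> //; apply: sub_ideal_trans KJ.
- case: (eqVneq i k) => [-> _|nik ik1]; last first.
    have ik : (i < k)%N by rewrite ltn_neqAle nik.
    by rewrite ik (ltnW ik); apply: sC.
  rewrite leqnn ltnn; have [iC [IC CK]] := hC k (leqnn k).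
  split; first by apply: sub_ideal_trans CK _; case: KK'.
  by move=> K'C; case: KK' => _; apply; apply: sub_ideal_trans CK.
Qed.

Lemma chainS_inv I J k : has_chain_between I J k.+1 ->
  exists K K', [/\ is_ideal K, is_ideal K' & sub_ideal I K] /\
  [/\ has_chain_between I K k, strict_sub K K' & sub_ideal K' J].
Proof.
move=> [C [hC sC]]; have [iK [IK _]] := hC k (leqnSn k).
have [iK' [_ K'J]] := hC k.+1 (leqnn _).
exists (C k), (C k.+1); split=> //; split; [ |exact: sC|by []].
have step i : (i < k)%N -> sub_ideal (C i) (C i.+1) by move=> /ltnW/sC [].
have mono i j : (i + j <= k)%N -> sub_ideal (C i) (C (i + j)%N).
  elim: j => [|j IH]; first by rewrite addn0 => _ x.
  rewrite addnS => ijk; apply: sub_ideal_trans (step _ ijk); exact/IH/ltnW.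
exists C; split=> [i ik|i ik]; last exact/sC/ltnW.
have [? [? _]] := hC i (leqW ik); do 2!split=> //.
by rewrite -(subnKC ik); apply: mono; rewrite subnKC.
Qed.

Lemma chain_sub I J I' J' k : sub_ideal I' I -> sub_ideal J J' ->
  has_chain_between I J k -> has_chain_between I' J' k.
Proof.
move=> II JJ [C [hC sC]]; exists C; split=> // i /hC [? [? ?]].
split=> //; split; [exact: sub_ideal_trans II _ | exact: sub_ideal_trans JJ].
Qed.

Lemma chain_leq I J k l : (l <= k)%N -> has_chain_between I J k -> has_chain_between I J l.
Proof.
move=> lk [C [hC sC]]; exists C; split=> i il; [apply: hC | apply: sC];
  exact: leq_trans lk.
Qed.

Lemma chain0 I J : is_ideal I -> sub_ideal I J -> has_chain_between I J 0.
Proof. by move=> iI IJ; exists (fun=> I). Qed.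

Lemma chain1 I J : is_ideal I -> is_ideal J -> strict_sub I J -> has_chain_between I J 1.
Proof.
move=> iI iJ IJ; apply: (chainS iI iJ _ _ IJ) => //.
exact: chain0.
Qed.

Lemma chainD I K J k l : is_ideal K -> sub_ideal I K ->
  has_chain_between I K k -> has_chain_between K J l -> has_chain_between I J (k + l).
Proof.
move=> iK IK hk; elim: l J => [|l IH] J.
  rewrite addn0 => -[C [/(_ 0%N (leqnn _)) [_ [h1 h2]] _]]; apply: chain_sub hk => //.
  exact: sub_ideal_trans h2.
move=> /chainS_inv [L [L' [[iL iL' KL] [hL LL' L'J]]]]; rewrite addnS.
by apply: (chainS iL iL' _ _ LL') => //; [apply: sub_ideal_trans KL | apply: IH].
Qed.

(** By modularity no strict step from [K] to [K'] can be lost both after intersecting with [M] and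
    after adding [M], so each step of the chain is charged to one of the two sides. *)
Lemma chain_split I J M k : is_ideal I -> is_ideal J -> is_ideal M ->
  sub_ideal I M -> sub_ideal I J -> has_chain_between I J k ->
  exists a b : nat, (a + b)%N = k /\ has_chain_between I (ideal_cap J M) a /\
    has_chain_between M (ideal_add J M) b.
Proof.
move=> iI + iM IM; elim: k J => [|k IH] J iJ IJ hk.
  exists 0%N, 0%N; split=> //; split; apply: chain0 => //.
    by move=> x Ix; split; [apply: IJ | apply: IM].
  exact: add_subr.
have [K [K' [[iK iK' IK] [hK [KK' nKK'] K'J]]]] := chainS_inv hk.
have [a [b [ab [ha hb]]]] := IH K iK IK hK.
have sMK : sub_ideal M (ideal_add K M) by apply: add_subr.
have addS (X Y : R -> Prop) : is_ideal Y -> sub_ideal X Y ->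
    sub_ideal (ideal_add X M) (ideal_add Y M).
  move=> iY XY; apply: add_min; [exact: add_is_ideal| |exact: add_subr].
  by apply: sub_ideal_trans XY _; apply: add_subl.
have sIK : sub_ideal I (ideal_cap K M) by move=> x Ix; split; [apply: IK | apply: IM].
have sJ : sub_ideal (ideal_cap K' M) (ideal_cap J M) by move=> x [/K'J].
case: (classic (sub_ideal (ideal_cap K' M) (ideal_cap K M))) => h.
- exists a, b.+1; split; [by rewrite addnS ab|split].
    by apply: chain_sub ha => // x [/KK' /K'J].
  apply: (@chainS _ _ (ideal_add K M) (ideal_add K' M)) => //; try exact: add_is_ideal.
  + split; [exact: addS|move=> h2; apply: nKK' => x K'x].
    have [y [z [Ky [Mz xE]]]] : ideal_add K M x by apply: h2; apply: add_subl.
    rewrite xE; apply: idealD => //.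
    have [] // : ideal_cap K M z.
    apply: h; split=> //; have -> : z = x - y by rewrite xE addrC addKr.
    by apply: idealB => //; apply: KK'.
  + exact: addS.
- exists a.+1, b; split; [by rewrite addSn ab|split]; last first.
    by apply: chain_sub hb => //; apply: addS => //; apply: sub_ideal_trans K'J.
  apply: (@chainS _ _ (ideal_cap K M) (ideal_cap K' M)) => //; try exact: cap_is_ideal.
  by split=> // x [/KK'].
Qed.

(** Upper half of the additivity of length: a longer chain would split into two parts, one of which
    exceeds its bound. *)
Lemma no_chainD I K J k l : is_ideal I -> is_ideal J -> is_ideal K ->
  sub_ideal I K -> sub_ideal K J ->
  ~ has_chain_between I K k.+1 -> ~ has_chain_between K J l.+1 ->
  ~ has_chain_between I J (k + l).+1.
Proof.
move=> iI iJ iK IK KJ nk nl h; have IJ := sub_ideal_trans IK KJ.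
have [a [b [ab [ha hb]]]] := chain_split iI iJ iK IK IJ h.
case: (leqP a k) => [ak|ka]; last first.
  by apply: nk; apply: chain_leq ka _; apply: chain_sub ha => // x [].
apply: nl; apply: (@chain_leq _ _ b); first by lia.
by apply: chain_sub hb => //; apply: add_min.
Qed.

Lemma length_eqD I K J k l : is_ideal I -> is_ideal J -> is_ideal K ->
  sub_ideal I K -> sub_ideal K J ->
  length_eq I K k -> length_eq K J l -> length_eq I J (k + l).
Proof.
move=> iI iJ iK IK KJ [hk nk] [hl nl]; split; first exact: chainD hk hl.
exact: no_chainD nk nl.
Qed.

Lemma length_eq_uniq I J k l : length_eq I J k -> length_eq I J l -> k = l.
Proof.
move=> [hk nk] [hl nl]; apply/eqP; rewrite eqn_leq; apply/andP; split.
- by rewrite leqNgt; apply/negP => lk; apply: nl; apply: chain_leq hk.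
- by rewrite leqNgt; apply/negP => lk; apply: nk; apply: chain_leq hl.
Qed.

Lemma length_eq_refl I : is_ideal I -> length_eq I I 0.
Proof.
move=> iI; split; first exact: chain0.
by move=> /chainS_inv [K [K' [[_ _ IK] [_ [_ nKK'] K'I]]]]; apply: nKK' => x /K'I /IK.
Qed.

Lemma bounded_length I J k : is_ideal I -> sub_ideal I J ->
  ~ has_chain_between I J k.+1 -> exists l, length_eq I J l.
Proof.
move=> iI IJ; elim: k => [|k IH] nk; first by exists 0%N; split=> //; apply: chain0.
by case: (classic (has_chain_between I J k.+1)) => [h|/IH //]; exists k.+1.
Qed.

Lemma chain_map (phi : (R -> Prop) -> R -> Prop) I J I' J' k :
  (forall K, is_ideal K -> sub_ideal I K -> sub_ideal K J ->
     [/\ is_ideal (phi K), sub_ideal I' (phi K) & sub_ideal (phi K) J']) ->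
  (forall K K', is_ideal K -> sub_ideal I K -> sub_ideal K J -> is_ideal K' ->
     sub_ideal I K' -> sub_ideal K' J -> strict_sub K K' -> strict_sub (phi K) (phi K')) ->
  has_chain_between I J k -> has_chain_between I' J' k.
Proof.
move=> h1 h2 [C [hC sC]]; exists (phi \o C); split=> i ik /=.
  by have [iC [IC CJ]] := hC i ik; have [? ? ?] := h1 _ iC IC CJ.
have [? [? ?]] := hC i (ltnW ik); have [? [? ?]] := hC i.+1 ik.
by apply: h2 => //; apply: sC.
Qed.

(** With [colon_chain], this expresses the isomorphism of [R / (B : x)] with [(B + (x)) / B] on
    chains. Strictness survives because an ideal [K] between [B] and [B + (x)] is recovered as
    [B + (K : x) x]. *)
Lemma chain_colon B x k : is_ideal B ->
  has_chain_between B (ideal_add B (principal x)) k ->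
  has_chain_between (colon B x) (@unit_ideal R) k.
Proof.
move=> iB; apply: (@chain_map (fun K => colon K x)).
  by move=> K iK BK KJ; split=> //; [apply: colon_is_ideal | move=> c; apply: BK].
move=> K K' iK BK KJ iK' BK' K'J [KK' nKK']; split; first by move=> c; apply: KK'.
move=> h; apply: nKK' => u K'u; have [b [_ [Bb [[c ->] uE]]]] := K'J u K'u.
rewrite uE; apply: idealD => //; first exact: BK.
apply: h; rewrite /colon; have -> : c * x = u - b by rewrite uE addrC addKr.
by apply: idealB => //; apply: BK'.
Qed.

Lemma colon_chain B x k : is_ideal B ->
  has_chain_between (colon B x) (@unit_ideal R) k ->
  has_chain_between B (ideal_add B (principal x)) k.
Proof.
move=> iB.
pose phi K := ideal_add B (fun y => exists2 c, K c & y = c * x).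
have iphi K : is_ideal K -> is_ideal (fun y => exists2 c, K c & y = c * x).
  move=> iK; split; first by exists 0; [apply: ideal0 | rewrite mul0r].
  split; first by move=> _ _ [c ? ->] [d ? ->]; exists (c + d);
    [apply: idealD | rewrite mulrDl].
  by move=> a _ [c ? ->]; exists (a * c); [apply: ideal_absorbl | rewrite mulrA].
apply: (@chain_map phi).
  move=> K iK BK KJ; split; first exact/add_is_ideal/iphi.
    exact/add_subl/iphi.
  apply: add_min; [exact: add_is_ideal | exact/add_subl/principal_is_ideal|].
  by move=> _ [c _ ->]; apply: add_subr => //; exists c.
move=> K K' iK BK KJ iK' BK' K'J [KK' nKK']; split.
  apply: add_min; [exact/add_is_ideal/iphi | exact/add_subl/iphi|].
  by move=> _ [c Kc ->]; apply: add_subr => //; exists c => //; apply: KK'.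
move=> h; apply: nKK' => c K'c.
have [b [_ [Bb [[d Kd ->] E]]]] : phi K (c * x).
  by apply: h; apply: add_subr => //; exists c.
have -> : c = d + (c - d) by rewrite addrC subrK.
apply: idealD => //; apply: BK; rewrite /colon mulrBl E addrK //.
Qed.

Lemma length_eq_colon B x l : is_ideal B -> length_eq (colon B x) (@unit_ideal R) l ->
  length_eq B (ideal_add B (principal x)) l.
Proof.
move=> iB [h n]; split; first exact: colon_chain.
by move=> h'; apply: n; apply: chain_colon.
Qed.

(* Adding [M] is injective on the ideals between [I] and [J], by modularity. *)
Lemma chain_add I J M k : is_ideal I -> is_ideal J -> is_ideal M ->
  sub_ideal (ideal_cap M J) I ->
  has_chain_between I J k -> has_chain_between M (@unit_ideal R) k.
Proof.
move=> iI iJ iM MJI; apply: (@chain_map (fun K => ideal_add K M)).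
  by move=> K iK IK KJ; split=> //; [apply: add_is_ideal | apply: add_subr].
move=> K K' iK IK KJ iK' IK' K'J [KK' nKK']; split.
  apply: add_min; [exact: add_is_ideal| |exact: add_subr].
  by move=> x /KK'; apply: add_subl.
move=> h; apply: nKK' => x K'x.
have [y [z [Ky [Mz xE]]]] : ideal_add K M x by apply: h; apply: add_subl.
rewrite xE; apply: idealD => //; apply/IK/MJI; split=> //.
by have -> : z = x - y by [rewrite xE addrC addKr]; apply: idealB => //; [apply: K'J|apply: KJ].
Qed.

End Length.

(** * Noetherian local rings *)

Section Noetherian.
Variable R : comNzRingType.
Hypothesis noeR : noetherian R.
Implicit Types (A B C I J K M P Q S : R -> Prop) (a b c x y : R) (k l : nat).

(** A failure at [I] would, by choice, yield an infinite strictly ascending chain of failing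
    ideals. *)
Lemma noetherian_ind (T : (R -> Prop) -> Prop) :
  (forall I, is_ideal I -> (forall J, is_ideal J -> strict_sub I J -> T J) -> T I) ->
  forall I, is_ideal I -> T I.
Proof.
move=> step I iI; apply: NNPP => nT.
pose X := {K | is_ideal K /\ ~ T K}.
have next (K : X) : exists K' : X, strict_sub (proj1_sig K) (proj1_sig K').
  case: K => K [iK nTK] /=; apply: NNPP => h; apply: nTK; apply: step => // J iJ KJ.
  by apply: NNPP => nTJ; apply: h; exists (exist _ J (conj iJ nTJ)).
pose f (K : X) := proj1_sig (constructive_indefinite_description _ (next K)).
have fP (K : X) : strict_sub (proj1_sig K) (proj1_sig (f K)).
  by rewrite /f; case: constructive_indefinite_description.
pose C n := iter n f (exist _ I (conj iI nT)).
have [N /(_ N.+1 (leqnSn N))] : exists N, forall n, (N <= n)%N ->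
    sub_ideal (proj1_sig (C n)) (proj1_sig (C N)).
  apply: noeR => n; first by case: (proj2_sig (C n)).
  by case: (fP (C n)).
by case: (fP (C N)).
Qed.

(** Noetherian induction over the finitely generated [K] inside [I]: as long as [K] is not [I],
    adjoin an element of [I] outside [K]. *)
Lemma ideal_fg I : is_ideal I -> exists s : seq R, I = ideal_span (fun x => x \in s).
Proof.
move=> iI.
suff h K : is_ideal K -> sub_ideal K I -> (exists s : seq R, K = ideal_span (fun x => x \in s)) ->
    exists s : seq R, I = ideal_span (fun x => x \in s).
  apply: (h (ideal_span (fun x => x \in [::]))) => //; last by exists [::].
  exact: span_min.
move: K; apply: noetherian_ind => K iK IH KI [s Ks].
case: (classic (sub_ideal I K)) => [IK|/not_sub_ideal [x [Ix nKx]]].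
  by exists s; rewrite -Ks; apply: sub_ideal_antisym.
have iS := span_is_ideal (fun y => y \in x :: s).
have Kx : sub_ideal K (ideal_span (fun y => y \in x :: s)).
  by rewrite Ks; apply: span_sub => y ys; rewrite inE ys orbT.
apply: (IH (ideal_span (fun y => y \in x :: s))) => //; last by exists (x :: s).
- split=> // h; apply: nKx; apply: h; apply: mem_span; exact: mem_head.
- apply: span_min => // y; rewrite inE => /predU1P[->//|ys].
  by apply: KI; rewrite Ks; apply: mem_span.
Qed.

Lemma ideal_mul_prime A B P : prime_ideal P -> sub_ideal (ideal_mul A B) P ->
  sub_ideal A P \/ sub_ideal B P.
Proof.
move=> [iP [_ pP]] ABP.
case: (classic (sub_ideal A P)) => [|/not_sub_ideal [a [Aa nPa]]].
  by left.
by right=> b Bb; case: (pP a b) => //; apply: ABP; apply: mem_mul.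
Qed.

Definition ideal_prods (s : seq (R -> Prop)) := foldr (@ideal_mul R) (@unit_ideal R) s.

Lemma prods_is_ideal s : List.Forall (@is_ideal R) s -> is_ideal (ideal_prods s).
Proof. by elim=> //= I t iI _ IH; apply: mul_is_ideal. Qed.

Lemma prods_cat s t : List.Forall (@is_ideal R) s -> List.Forall (@is_ideal R) t ->
  ideal_prods (s ++ t) = ideal_mul (ideal_prods s) (ideal_prods t).
Proof.
move=> + it; elim=> /= [|I u iI iu IH].
  by rewrite ideal_mul1l //; apply: prods_is_ideal.
by rewrite IH ideal_mulA //; apply: prods_is_ideal.
Qed.

Definition primes_over I (s : seq (R -> Prop)) :=
  List.Forall (fun P => prime_ideal P /\ sub_ideal I P) s.

Lemma primes_over_ideal I s : primes_over I s -> List.Forall (@is_ideal R) s.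
Proof. by apply: List.Forall_impl => P [[iP _] _]. Qed.

(** Stands in for the finiteness of minimal primes. If [x y] lies in [I] but neither factor does,
    the product of [I + (x)] and [I + (y)] lies in [I], so the lists obtained for these two larger
    ideals are concatenated. *)
Lemma primes_over_prods I : is_ideal I ->
  exists2 s, primes_over I s & sub_ideal (ideal_prods s) I.
Proof.
move: I; apply: noetherian_ind => I iI IH.
case: (classic (I 1)) => [I1|nI1].
  by exists [::] => [|x _]; [apply: List.Forall_nil | apply: ideal1].
case: (classic (forall x y, I (x * y) -> I x \/ I y)) => [pI|].
  by exists [:: I] => [|x /mul_subl]; [apply: List.Forall_cons | apply].
move=> npI; have [x [y [Ixy nIx nIy]]] : exists x y, [/\ I (x * y), ~ I x & ~ I y].
  apply: NNPP => h; apply: npI => x y Ixy.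
  case: (classic (I x)) => [|nIx]; first by left.
  by right; apply: NNPP => nIy; apply: h; exists x, y.
have [s hs sI] := IH _ (add_principal_is_ideal x iI) (strict_add_principal iI nIx).
have [t ht tI] := IH _ (add_principal_is_ideal y iI) (strict_add_principal iI nIy).
have w u z : primes_over (ideal_add I (principal z)) u -> primes_over I u.
  apply: List.Forall_impl => P [pP IP]; split=> //; apply: sub_ideal_trans IP.
  exact: add_subl.
exists (s ++ t); first by apply/List.Forall_app; split; [apply: w hs|apply: w ht].
rewrite prods_cat; [|exact: primes_over_ideal hs|exact: primes_over_ideal ht].
apply: mul_min => // a b /sI [u [_ [Iu [[c ->] ->]]]] /tI [v [_ [Iv [[d ->] ->]]]].
have -> : (u + c * x) * (v + d * y) = (v + d * y) * u + (c * x) * v + (c * d) * (x * y).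
  by ring.
by apply: idealD => //; [apply: idealD => //|]; apply: ideal_absorbl.
Qed.

Lemma prime_avoidance A (s : seq (R -> Prop)) : is_ideal A ->
  List.Forall (fun P => prime_ideal P /\ ~ sub_ideal A P) s ->
  exists2 x, A x & List.Forall (fun P => ~ P x) s.
Proof.
move=> iA; have [n] := ubnP (size s); elim: n s => // n IH [|P s] /=.
  by move=> _ _; exists 0; [apply: ideal0 | apply: List.Forall_nil].
rewrite ltnS => sn /List.Forall_cons_iff [[pP nAP] hs].
have [iP [nP1 mP]] := pP.
case: (classic (exists Q, List.In Q s /\ sub_ideal Q P)) => [[Q [Qs QP]]|nQ].
  have [s1 [s2 sE]] := List.in_split _ _ Qs; subst s.
  have [hs1 /List.Forall_cons_iff [hQ hs2]] := proj1 (List.Forall_app _ _ _) hs.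
  have sn' : (size (P :: s1 ++ s2) < n)%N by move: sn; rewrite /= !size_cat /= addnS.
  have [|x Ax /List.Forall_cons_iff [nPx /List.Forall_app [h1 h2]]] := IH _ sn'.
    by apply: List.Forall_cons => //; apply/List.Forall_app.
  exists x => //; apply: List.Forall_cons => //; apply/List.Forall_app.
  by split=> //; apply: List.Forall_cons => // /QP.
have [x Ax hx] := IH s sn hs.
case: (classic (P x)) => [Px|nPx]; last by exists x => //; apply: List.Forall_cons.
have [w [Aw nPw]] := not_sub_ideal nAP.
(* [z] is the product of an element of [A] outside [P] and, for each [Q] in [s], an element of [Q]
   outside [P]; primality keeps it outside [P]. *)
have [z [Az nPz] hz] : exists2 z, A z /\ ~ P z & List.Forall (fun Q => Q z) s.
  elim: s {sn hx} hs nQ => [|Q s IHs] hs nQ.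
    by exists w => //; apply: List.Forall_nil.
  have [[[iQ _] _] hs'] := proj1 (List.Forall_cons_iff _ _ _) hs.
  have [|z [Az nPz] hz] := IHs hs'.
    by move=> [Q' [Q's Q'P]]; apply: nQ; exists Q'; split=> //; right.
  have [v [Qv nPv]] : exists v, Q v /\ ~ P v.
    by apply: not_sub_ideal => QP; apply: nQ; exists Q; split=> //; left.
  exists (v * z); first by split; [apply: ideal_absorbl | case/mP].
  apply: List.Forall_cons; first exact: (ideal_absorbr z iQ Qv).
  have is' : List.Forall (@is_ideal R) s by apply: List.Forall_impl hs' => Q' [[]].
  elim: {hs hs' nQ IHs} s is' hz => [|Q' s IHs]; first by move=> *; apply: List.Forall_nil.
  move=> /List.Forall_cons_iff [? ?] /List.Forall_cons_iff [? ?].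
  by apply: List.Forall_cons; [apply: ideal_absorbl | apply: IHs].
exists (x + z); first exact: idealD.
apply: List.Forall_cons.
  by move=> h; apply: nPz; rewrite -(addKr x z) addrC; apply: idealB.
have is' : List.Forall (@is_ideal R) s by apply: List.Forall_impl hs => Q' [[]].
elim: s {hs sn nQ} is' hz hx => [|Q s IHs]; first by move=> *; apply: List.Forall_nil.
move=> /List.Forall_cons_iff [iQ ?] /List.Forall_cons_iff [Qz ?] /List.Forall_cons_iff [nQx ?].
apply: List.Forall_cons; last exact: IHs.
by move=> h; apply: nQx; rewrite -(addrK z x); apply: idealB.
Qed.

Variable m : R -> Prop.
Hypothesis mmax : maximal_ideal m.
Hypothesis muniq : forall M, maximal_ideal M -> (forall x, M x <-> m x).

Lemma max_is_ideal : is_ideal m. Proof. by case: mmax. Qed.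
Let im := max_is_ideal.
#[local] Hint Resolve im : core.

(** Noetherian induction replaces Zorn's lemma: a proper ideal that is not maximal has a strictly
    larger proper one. *)
Lemma proper_sub_max I : is_ideal I -> ~ I 1 -> sub_ideal I m.
Proof.
move: I; apply: noetherian_ind => I iI IH nI1.
case: (classic (maximal_ideal I)) => [mI x /(muniq mI) //|nmI].
have [J iJ [IJ nJI nJ1]] : exists2 J, is_ideal J & [/\ sub_ideal I J, ~ sub_ideal J I & ~ J 1].
  apply: NNPP => h; apply: nmI; do 2!split=> //; move=> J iJ IJ.
  case: (classic (J 1)) => [|nJ1]; first by left.
  by right; apply: NNPP => nJI; apply: h; exists J.
exact: sub_ideal_trans IJ (IH J iJ (conj IJ nJI) nJ1).
Qed.

Lemma unit_sub_max a : m a -> exists u, u * (1 - a) = 1.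
Proof.
move=> ma; apply: NNPP => h.
have mI : sub_ideal (principal (1 - a)) m.
  by apply: proper_sub_max => // -[u E]; apply: h; exists u.
have [_ [+ _]] := mmax; apply; rewrite -(subrK a 1); apply: idealD => //.
by apply: mI; exists 1; rewrite mul1r.
Qed.

Lemma max_prime : prime_ideal m.
Proof.
have [_ [m1 mM]] := mmax; split=> //; split=> // x y mxy.
case: (classic (m x)) => [|nmx]; [by left|right].
case: (mM _ (add_principal_is_ideal x im)) => [|[u [_ [mu [[c ->] E]]]]|h].
- exact: add_subl.
- have -> : y = u * y + c * (x * y) by rewrite mulrA -mulrDl -E mul1r.
  by apply: idealD => //; [apply: ideal_absorbr | apply: ideal_absorbl].
- by case: nmx; apply: h; apply: mem_add_principal.
Qed.

Lemma no_chain_max : ~ has_chain_between m (@unit_ideal R) 2.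
Proof.
move=> /chainS_inv [K [K' [[iK iK' mK] [/chainS_inv [L [L' [[iL iL' mL] [_ [LL' nL'L] L'K]]]]]]]].
case=> KK' nK'K _; have [_ [_ /(_ K iK mK)]] := mmax; case=> [K1|Km].
  by apply: nK'K => x _; apply: ideal1.
by apply: nL'L => x /L'K /Km /mL.
Qed.

(** Dropping the top of a longest chain gives [K] of length one less over [I], to which induction
    applies. Moreover [m J] lies in [K], since otherwise the chain could be refined to one that is
    too long. *)
Lemma max_exp_mul_sub I J l : is_ideal I -> is_ideal J -> sub_ideal I J ->
  length_eq I J l -> sub_ideal (ideal_mul (ideal_exp m l) J) I.
Proof.
move=> iI + IJ; elim: l J IJ => [|l IH] J IJ iJ [hc nc].
  rewrite ideal_mul1l //; apply: NNPP => h; apply: nc.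
  exact: chain1.
have [K [K' [[iK iK' IK] [hK KK' K'J]]]] := chainS_inv hc.
have KJ : sub_ideal K J by apply: sub_ideal_trans K'J; case: KK'.
have hmK : sub_ideal (ideal_mul (ideal_exp m l) K) I.
  apply: IH => //; split=> // hK'; apply: nc.
  exact: chainS hK' KK' K'J.
apply: sub_ideal_trans hmK; rewrite ideal_expS (ideal_mulC m) -ideal_mulA //;
  last exact: exp_is_ideal.
apply: mul_sub => //; apply: mul_min => // a x ma Jx; apply: NNPP => nKax; apply: nc.
have iKax := add_principal_is_ideal (a * x) iK; have iKx := add_principal_is_ideal x iK.
rewrite -addn2; apply: (chainD iK IK hK).
(* Two strict steps lead from [K] through [K + (a x)] to [K + (x)]. The second is strict in the
   manner of Nakayama: [x = u + c a x] with [u] in [K] would put [x] in [K], because [1 - c a] is a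
   unit. *)
apply: (@chainS _ _ _ (ideal_add K (principal (a * x))) (ideal_add K (principal x))) => //.
- exact: add_subl.
- by apply: chain1 => //; apply: strict_add_principal.
- split.
    apply: add_principal_min => //; first exact: add_subl.
    by apply: add_subr => //; exists a.
  move=> /(_ x (mem_add_principal x iK)) [u [_ [Ku [[c ->] E]]]].
  have [v vE] := @unit_sub_max (c * a) (ideal_absorbl c im ma).
  apply: nKax; apply: ideal_absorbl => //; rewrite -[x]mul1r -vE -mulrA; apply: ideal_absorbl => //.
  by have -> : (1 - c * a) * x = u by rewrite mulrBl mul1r -mulrA {1}E addrK.
- exact: add_principal_min.
Qed.

(** Insert [A + (a b) + (a)]. The quotient above it is bounded by [R / (A + (a))]; the one below is
    cyclic, generated by [a] and killed by [A + (b)]. *)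
Lemma no_chain_mul A a b k l : is_ideal A ->
  ~ has_chain_between (ideal_add A (principal a)) (@unit_ideal R) k.+1 ->
  ~ has_chain_between (ideal_add A (principal b)) (@unit_ideal R) l.+1 ->
  ~ has_chain_between (ideal_add A (principal (a * b))) (@unit_ideal R) (k + l).+1.
Proof.
move=> iA nk nl; have iAab := add_principal_is_ideal (a * b) iA.
have iAa := add_principal_is_ideal a iA; have iAb := add_principal_is_ideal b iA.
rewrite addnC.
apply: (@no_chainD _ _ (ideal_add (ideal_add A (principal (a * b))) (principal a))) => //.
- exact: add_is_ideal.
- exact: add_subl.
- move=> /(chain_colon iAab) h; apply: nl; apply: chain_sub h => //.
  apply: add_principal_min; first exact: colon_is_ideal.
    by move=> x Ax; apply: add_subl => //; apply: ideal_absorbr.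
  by rewrite /colon mulrC; apply: mem_add_principal.
- move=> h; apply: nk; apply: chain_sub h => //; apply: add_principal_min.
  + exact: add_is_ideal.
  + by apply: (@sub_ideal_trans _ _ (ideal_add A (principal (a * b)))); apply: add_subl.
  + exact: mem_add_principal.
Qed.

Lemma no_chain_exp A a k n : is_ideal A ->
  ~ has_chain_between (ideal_add A (principal a)) (@unit_ideal R) k.+1 ->
  ~ has_chain_between (ideal_add A (principal (a ^+ n))) (@unit_ideal R) (n * k).+1.
Proof.
move=> iA nk; elim: n => [|n IH]; last by rewrite exprS mulSn; apply: no_chain_mul.
move=> /chainS_inv [K [K' [[_ _ IK] [_ [_ nK'K] _]]]]; apply: nK'K => x _.
by apply: IK; apply: add_subr => //; exists x; rewrite mulr1.
Qed.

Lemma span_cons (x : R) s : ideal_span (fun y => y \in x :: s) =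
  ideal_add (ideal_span (fun y => y \in s)) (principal x).
Proof.
apply: sub_ideal_antisym.
- apply: span_min; first exact: add_is_ideal.
  move=> y; rewrite inE => /predU1P[->|ys]; first exact: mem_add_principal.
  by apply: add_subl => //; apply: mem_span.
- apply: add_principal_min => //; last by apply: mem_span; apply: mem_head.
  by apply: span_sub => y ys; rewrite inE ys orbT.
Qed.

(** Generators are raised to the power [n] one at a time, each multiplying the bound by [n]. *)
Lemma no_chain_span_exp (s : seq R) k n :
  ~ has_chain_between (ideal_span (fun x => x \in s)) (@unit_ideal R) k.+1 ->
  ~ has_chain_between (ideal_span (fun x => x \in [seq y ^+ n | y <- s])) (@unit_ideal R)
      (n ^ size s * k).+1.
Proof.
(* [t] holds generators kept to the first power while those of [s] are raised. *)
suff h t : ~ has_chain_between (ideal_span (fun x => x \in t ++ s)) (@unit_ideal R) k.+1 ->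
  ~ has_chain_between (ideal_span (fun x => x \in t ++ [seq y ^+ n | y <- s])) (@unit_ideal R)
      (n ^ size s * k).+1 by apply: (h [::]).
elim: s t => [|x s IH] t /= nk; first by rewrite mul1n.
have E u y : (fun z : R => z \in rcons t y ++ u) = (fun z => z \in y :: t ++ u) :> (R -> Prop).
  apply: functional_extensionality => z.
  by rewrite mem_cat mem_rcons !inE mem_cat orbA.
have E' u y : (fun z : R => z \in t ++ y :: u) = (fun z => z \in y :: t ++ u) :> (R -> Prop).
  by rewrite -E; apply: functional_extensionality => z; rewrite cat_rcons.
rewrite E' span_cons expnS -mulnA; apply: no_chain_exp => //.
by rewrite -span_cons -E; apply: IH; rewrite E -E'.
Qed.

Lemma span_exp_sub A (s : seq R) n : is_ideal A -> sub_ideal (ideal_span (fun x => x \in s)) A ->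
  sub_ideal (ideal_span (fun x => x \in [seq y ^+ n | y <- s])) (ideal_exp A n).
Proof.
move=> iA sA; apply: span_min; first exact: exp_is_ideal.
by move=> _ /mapP[y ys ->]; apply: mem_exp; apply: sA; apply: mem_span.
Qed.

(** [R / m] has length at most one, so the length modulo the [n]-th powers of generators of [m] is
    bounded, and these powers lie in [m^n]. *)
Lemma no_chain_max_exp n : exists k, ~ has_chain_between (ideal_exp m n) (@unit_ideal R) k.+1.
Proof.
have [s sE] := ideal_fg im.
have h : ~ has_chain_between (ideal_span (fun x => x \in s)) (@unit_ideal R) 2.
  by rewrite -sE; apply: no_chain_max.
exists (n ^ size s * 1)%N => h2; apply: (no_chain_span_exp h (n := n)).
by apply: chain_sub h2 => //; apply: span_exp_sub => //; rewrite -sE.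
Qed.

(** * Prime chains and parameter ideals *)

Definition chain_below k P := exists C : nat -> R -> Prop,
  [/\ (forall i, (i <= k)%N -> prime_ideal (C i)),
      (forall i, (i < k)%N -> strict_sub (C i) (C i.+1)) & C k = P].

Lemma chain_belowS k P Q : chain_below k P -> prime_ideal Q -> strict_sub P Q ->
  chain_below k.+1 Q.
Proof.
move=> [C [pC sC CP]] pQ PQ.
exists (fun i => if (i <= k)%N then C i else Q); split; last by rewrite ltnn.
- by move=> i _; case: ifP => // /pC.
- move=> i ik1; case: (eqVneq i k) => [->|nik]; first by rewrite leqnn ltnn CP.
  have ik : (i < k)%N by rewrite ltn_neqAle nik.
  by rewrite ik (ltnW ik); apply: sC.
Qed.

Lemma prime_over_prods (s : seq (R -> Prop)) P : prime_ideal P ->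
  sub_ideal (ideal_prods s) P -> exists2 Q, List.In Q s & sub_ideal Q P.
Proof.
move=> pP; elim: s => [|Q s IH] /= h; first by case: pP => _ [+ _]; case; apply: h.
case: (ideal_mul_prime pP h) => [QP|/IH [Q' ? ?]]; first by exists Q; [left|].
by exists Q' => //; right.
Qed.

(** Each new element avoids the primes other than [m] in a finite list of primes over the previous
    ideal. After [d] steps a prime other than [m] over the ideal would end a chain of length [d],
    which [m] would prolong beyond the dimension. So only [m] lies over the ideal, and a product of
    primes inside it is a power of [m]. *)
Lemma parameters d : ~ has_prime_chain R d.+1 -> exists s : seq R,
  [/\ size s = d, sub_ideal (ideal_span (fun x => x \in s)) m &
      exists e, sub_ideal (ideal_exp m e) (ideal_span (fun x => x \in s))].
Proof.
move=> nch.
have [s [sd sm hP]] : exists s : seq R, [/\ size s = d,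
    sub_ideal (ideal_span (fun x => x \in s)) m &
    forall P, prime_ideal P -> sub_ideal (ideal_span (fun x => x \in s)) P ->
      P = m \/ chain_below d P].
  elim: {nch} d => [|d [s [sd sm hP]]].
    exists [::]; split=> //; first exact: span_min.
    by move=> P pP _; right; exists (fun=> P).
  have [t ht tI] := primes_over_prods (span_is_ideal (fun x => x \in s)).
  (* The new element must come from [m], so [m] itself cannot be avoided and is removed from the
     list. *)
  pose t' := List.filter (fun P => if excluded_middle_informative (P = m) then false else true) t.
  have [|x mx hx] := @prime_avoidance m t' im.
    apply/List.Forall_forall => P /List.filter_In [Pt].
    case: excluded_middle_informative => // nPm _.
    have [pP sP] := proj1 (List.Forall_forall _ _) ht P Pt.
    split=> // mP; apply: nPm; apply: sub_ideal_antisym => //.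
    by have [iP [nP1 _]] := pP; apply: proper_sub_max.
  exists (x :: s); split; first by rewrite /= sd.
    by rewrite span_cons; apply: add_principal_min.
  rewrite span_cons => P pP sP.
  have [iP [nP1 _]] := pP; have Pm := proper_sub_max iP nP1.
  have [Q Qt QP] : exists2 Q, List.In Q t & sub_ideal Q P.
    apply: prime_over_prods => //; apply: sub_ideal_trans tI _.
    by apply: sub_ideal_trans sP; apply: add_subl.
  have [pQ sQ] := proj1 (List.Forall_forall _ _) ht Q Qt.
  case: (classic (Q = m)) => [Qm|nQm].
    by left; apply: sub_ideal_antisym => //; rewrite -Qm.
  right; case: (hP Q pQ sQ) => // chQ; apply: chain_belowS chQ pP _; split=> // PQ.
  apply: (proj1 (List.Forall_forall _ _) hx Q).
    by apply/List.filter_In; split=> //; case: excluded_middle_informative.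
  by apply: PQ; apply: sP; apply: mem_add_principal.
exists s; split=> //.
have [t ht tI] := primes_over_prods (span_is_ideal (fun x => x \in s)).
exists (size t); apply: sub_ideal_trans tI.
elim: t ht => [|P t IH] //= /List.Forall_cons_iff [[pP sP] ht].
suff -> : P = m by apply: mul_sub => //; apply: IH.
case: (hP P pP sP) => // chP; apply: NNPP => nPm; apply: nch.
have [iP [nP1 _]] := pP; have Pm := proper_sub_max iP nP1.
have [|C [? ? _]] := @chain_belowS _ P m chP max_prime; last by exists C.
by split=> // mP; apply: nPm; apply: sub_ideal_antisym.
Qed.

(* A parameter ideal [(x_1, .., x_d)] bounds [l(R/m^n)] by
   [l(R/(x_1^n, .., x_d^n)) <= n^d l(R/(x_1, .., x_d))]. *)
Lemma max_exp_growth d : ~ has_prime_chain R d.+1 ->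
  exists k, forall n, ~ has_chain_between (ideal_exp m n) (@unit_ideal R) (n ^ d * k).+1.
Proof.
move=> /parameters [s [<- sm [e es]]]; have [k nk] := no_chain_max_exp e.
exists k => n h; have h' : ~ has_chain_between (ideal_span (fun x => x \in s)) (@unit_ideal R) k.+1.
  by move=> h'; apply: nk; apply: chain_sub h'.
apply: (no_chain_span_exp h' (n := n)); apply: chain_sub h => //.
exact: span_exp_sub.
Qed.

End Noetherian.

(** * Exponent vectors *)

(** Exponent vectors are plain lists, for recursion on the variables; lengths are controlled by
    hypotheses of the lemmas. *)
Fixpoint madd (a b : seq nat) : seq nat :=
  match a, b with
  | x :: a', y :: b' => (x + y)%N :: madd a' b'
  | _, _ => [::]
  end.

Fixpoint lexm (a b : seq nat) : bool :=
  match a, b with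
  | x :: a', y :: b' => (x < y)%N || ((x == y) && lexm a' b')
  | _, _ => false
  end.

Definition leqm (a b : seq nat) := all2 leq a b.

Definition truncm c (a : seq nat) := [seq minn k c | k <- a].

Fixpoint unitm g j : seq nat :=
  match g, j with
  | 0, _ => [::]
  | g'.+1, 0 => 1%N :: nseq g' 0%N
  | g'.+1, j'.+1 => 0%N :: unitm g' j'
  end.

Lemma size_madd a b : size a = size b -> size (madd a b) = size a.
Proof. by elim: a b => [|x a IH] [|y b] //= [/IH ->]. Qed.

Lemma size_unitm g j : size (unitm g j) = g.
Proof. by elim: g j => [|g IH] [|j] //=; rewrite ?size_nseq ?IH. Qed.

Lemma size_truncm c a : size (truncm c a) = size a.
Proof. exact: size_map. Qed.

Lemma maddC a b : madd a b = madd b a.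
Proof. by elim: a b => [|x a IH] [|y b] //=; rewrite IH addnC. Qed.

Lemma madd0 a : madd a (nseq (size a) 0%N) = a.
Proof. by elim: a => //= x a ->; rewrite addn0. Qed.

Lemma lexm_irr a : lexm a a = false.
Proof. by elim: a => //= x a ->; rewrite ltnn eqxx. Qed.

Lemma lexm_asym a b : lexm a b -> lexm b a = false.
Proof. by elim: a b => [|x a IH] [|y b] //=; case: ltngtP => //= _; apply: IH. Qed.

Lemma lexm_add2r c a b : size a = size c -> size b = size c ->
  lexm (madd a c) (madd b c) = lexm a b.
Proof.
elim: c a b => [|z c IH] [|x a] [|y b] //= [sa] [sb].
by rewrite ltn_add2r eqn_add2r IH.
Qed.

(** Replacing a variable by a later one lowers the monomial; with the [z] first, trading a [z] for a
    [y] is a descent. *)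
Lemma lexm_unitm g j l : (j < l < g)%N -> lexm (unitm g l) (unitm g j).
Proof. by elim: g j l => [|g IH] [|j] [|l] //=; rewrite ?andbF //; apply: IH. Qed.

Lemma leqm_madd a b : leqm a b -> exists2 c, size c = size a & b = madd a c.
Proof.
elim: a b => [|x a IH] [|y b] //=; first by exists [::].
move=> /andP[xy /IH [c sc ->]]; exists ((y - x)%N :: c); first by rewrite /= sc.
by rewrite /= subnKC.
Qed.

Lemma leqm_trunc_leq c c' a : (c <= c')%N -> leqm (truncm c a) (truncm c' a).
Proof. by rewrite /leqm => cc'; elim: a => //= x a ->; rewrite andbT; lia. Qed.

Lemma leqm_trunc c a : leqm (truncm c a) a.
Proof. by rewrite /leqm; elim: a => //= x a ->; rewrite geq_minl. Qed.

Lemma unitm_factor a j : (0 < nth 0 a j)%N ->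
  exists2 b, size b = size a & a = madd b (unitm (size a) j).
Proof.
elim: a j => [|x a IH] [|j] //=.
  move=> x0; exists (x.-1 :: a) => //=.
  by rewrite addn1 prednK // madd0.
by move=> /IH [b sb aE]; exists (x :: b); rewrite /= ?sb // addn0 -aE.
Qed.

(** Monotonicity in [k] lets the maximum of finitely many thresholds serve all [b] at once. *)
Lemma bounded_uniform (Q : nat -> nat -> Prop) c :
  (forall k k' b, (k <= k')%N -> Q k b -> Q k' b) ->
  (forall b, (b <= c)%N -> exists k, Q k b) ->
  exists k, forall b, (b <= c)%N -> Q k b.
Proof.
move=> mQ; elim: c => [|c IH] h.
  by have [k Qk] := h 0%N (leqnn _); exists k => b; rewrite leqn0 => /eqP->.
have [|k hk] := IH; first by move=> b bc; apply/h/leqW.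
have [k' hk'] := h c.+1 (leqnn _); exists (maxn k k') => b.
rewrite leq_eqVlt => /predU1P[->|bc]; first exact: mQ (leq_maxr _ _) hk'.
exact: mQ (leq_maxl _ _) (hk b bc).
Qed.

Lemma box_uniform (Q : nat -> seq nat -> Prop) g c :
  (forall k k' b, (k <= k')%N -> Q k b -> Q k' b) ->
  (forall b, size b = g -> exists k, Q k b) ->
  exists k, forall b, size b = g -> all (leq^~ c) b -> Q k b.
Proof.
elim: g Q => [|g IH] Q mQ h.
  by have [k hk] := h [::] erefl; exists k => -[].
have [|x xc|k hk] := @bounded_uniform (fun k x => forall b, size b = g -> all (leq^~ c) b ->
    Q k (x :: b)) c.
- by move=> k k' x kk' hk b sb bc; apply: mQ kk' _; apply: hk.
- apply: (IH (fun k b => Q k (x :: b))) => [k k' b|b sb]; first exact: mQ.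
  by apply: h; rewrite /= sb.
- by exists k => -[|x b] //= [sb] /andP[xc bc]; apply: hk.
Qed.

(** * Stability of monotone families of ideals *)

Section Stability.
Variable R : comNzRingType.
Hypothesis noeR : noetherian R.

(* Induction on the number of variables: apply the induction hypothesis to the union of [L] along
   the first coordinate, and to the finitely many slices before it is reached. *)
Lemma monotone_stable g (L : seq nat -> R -> Prop) :
  (forall a, size a = g -> is_ideal (L a)) ->
  (forall a b, size a = g -> leqm a b -> sub_ideal (L a) (L b)) ->
  exists c, forall c' a, (c <= c')%N -> size a = g -> sub_ideal (L a) (L (truncm c' a)).
Proof.
elim: g L => [|g IH] L iL mL; first by exists 0%N => c' [].
have leqm_refl a : leqm a a by rewrite /leqm; elim: a => //= x a ->; rewrite leqnn.
have mk a k k' : size a = g -> (k <= k')%N -> sub_ideal (L (k :: a)) (L (k' :: a)).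
  by move=> sa kk'; apply: mL; rewrite /= ?sa // /leqm /= kk'; apply: leqm_refl.
pose U a x := exists k, L (k :: a) x.
have iU a : size a = g -> is_ideal (U a).
  move=> sa; have iLk k : is_ideal (L (k :: a)) by apply: iL; rewrite /= sa.
  split; first by exists 0%N; apply: ideal0.
  split; last by move=> c x [k Lx]; exists k; apply: ideal_absorbl.
  move=> x y [k Lx] [l Ly]; exists (maxn k l); apply: idealD => //.
    by move: Lx; apply: mk => //; apply: leq_maxl.
  by move: Ly; apply: mk => //; apply: leq_maxr.
have [|c1 hc1] := IH U iU.
  move=> a b sa ab x [k Lx]; exists k; move: Lx; apply: mL; first by rewrite /= sa.
  by rewrite /leqm /= leqnn.
have [|b sb|k0 hk0] := @box_uniform (fun k a => size a = g -> sub_ideal (U a) (L (k :: a))) g c1.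
- by move=> k k' b kk' h sb; apply: sub_ideal_trans (h sb) _; apply: mk.
- have [||N hN] := @noeR (fun k => L (k :: b)).
  + by move=> k; apply: iL; rewrite /= sb.
  + by move=> k; apply: mk.
  exists N => _ x [k Lx]; apply: (hN (maxn N k)); first exact: leq_maxl.
  by move: Lx; apply: mk => //; apply: leq_maxr.
have [|b _|c2 hc2] := @bounded_uniform (fun c b => forall c' a, (c <= c')%N -> size a = g ->
    sub_ideal (L (b :: a)) (L (b :: truncm c' a))) k0.
- by move=> k k' b kk' h c' a kc'; apply: h; apply: leq_trans kc'.
- apply: (IH (fun a => L (b :: a))) => [a sa|a a' sa aa']; first by apply: iL; rewrite /= sa.
  by apply: mL; rewrite /= ?sa // /leqm /= leqnn.
exists (maxn (maxn c1 c2) k0) => c' [|k a] //; rewrite !geq_max => /andP[/andP[c1c c2c] k0c] [sa].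
have [kk0|k0k] := leqP k k0.
  by rewrite /= (minn_idPl (leq_trans kk0 k0c)); apply: hc2.
(* Beyond [k0]: enlarge the slice to the union, truncate the tail at [c1], and come back to the
   slice at [k0], which has reached the union on the box bounded by [c1]. *)
have tl : sub_ideal (L (k :: a)) (U a) by move=> x; exists k.
apply: sub_ideal_trans tl (sub_ideal_trans (hc1 c1 a (leqnn _) sa) _).
have st : size (truncm c1 a) = g by rewrite size_truncm.
apply: (@sub_ideal_trans _ _ (L (k0 :: truncm c1 a))).
  by apply: hk0 => //; apply/allP => x /mapP[y _ ->]; apply: geq_minr.
apply: mL; first by rewrite /= st.
by rewrite /leqm /= leq_min (ltnW k0k) k0c; apply: leqm_trunc_leq.
Qed.

End Stability.

(** * Monomials of given multidegree *)

Section Degree.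
Variable G : finType.
Implicit Types (gs : seq G) (n : G -> nat).

(** [gs] records, for each variable, the index of the ideal whose generator it stands for. *)
Fixpoint degm gs (mu : seq nat) (i : G) : nat :=
  match gs, mu with
  | g :: gs', k :: mu' => ((g == i) * k + degm gs' mu' i)%N
  | _, _ => 0%N
  end.

Lemma degm_madd gs a b i : size a = size gs -> size b = size gs ->
  degm gs (madd a b) i = (degm gs a i + degm gs b i)%N.
Proof.
elim: gs a b => [|g gs IH] [|x a] [|y b] //= [sa] [sb].
by rewrite IH // mulnDr addnACA.
Qed.

Lemma degm_nseq0 gs k i : degm gs (nseq k 0%N) i = 0%N.
Proof. by elim: gs k => [|g gs IH] [|k] //=; rewrite IH muln0. Qed.

Lemma degm_unitm gs j i g0 : (j < size gs)%N ->
  degm gs (unitm (size gs) j) i = (nth g0 gs j == i).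
Proof.
elim: gs j => [|g gs IH] [|j] //=; first by rewrite degm_nseq0 muln1 addn0.
by rewrite ltnS => /IH; rewrite muln0.
Qed.

Lemma degm_gt0 gs mu i : size mu = size gs -> (0 < degm gs mu i)%N ->
  exists j, [/\ (j < size gs)%N, nth i gs j = i & (0 < nth 0 mu j)%N].
Proof.
elim: gs mu => [|g gs IH] [|k mu] //= [sm].
case: (posnP ((g == i) * k)) => [-> /(IH _ sm) [j [? ? ?]]|]; first by exists j.+1.
by rewrite muln_gt0 lt0b => /andP[/eqP-> k0] _; exists 0%N.
Qed.

Lemma degm_leq_sum gs mu i c : all (leq^~ c) mu -> (degm gs mu i <= size gs * c)%N.
Proof.
elim: gs mu => [|g gs IH] [|k mu] //= /andP[kc /IH h].
by rewrite mulSn leq_add //; case: (g == i); rewrite ?mul1n.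
Qed.

(** The recursion lists vectors in increasing lexicographic order, so that prefixes give the
    filtration by leading monomial. The subtraction never truncates, since [k] runs only up to
    [n g]. *)
Fixpoint mons gs n : seq (seq nat) :=
  match gs with
  | [::] => if [forall i, n i == 0%N] then [:: [::]] else [::]
  | g :: gs' => flatten [seq [seq k :: mu | mu <- mons gs' (fun i => n i - (g == i) * k)%N]
                        | k <- iota 0 (n g).+1]
  end.

Lemma mons_cons g gs n : mons (g :: gs) n =
  flatten [seq [seq k :: mu | mu <- mons gs (fun i => n i - (g == i) * k)%N]
          | k <- iota 0 (n g).+1].
Proof. by []. Qed.

Lemma mem_mons gs n mu :
  (mu \in mons gs n) = (size mu == size gs) && [forall i, degm gs mu i == n i].
Proof.
elim: gs n mu => [|g gs IH] n mu.
  case: mu => [|k mu] /=; last by case: ifP.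
  by rewrite /=; under eq_forallb do rewrite eq_sym; case: ifP.
apply/flatten_mapP/idP => [[k]|].
  rewrite mem_iota /= add0n ltnS => kn /mapP[mu' + ->]; rewrite IH => /andP[/eqP sm /forallP h].
  rewrite /= sm eqxx; apply/forallP => i; rewrite (eqP (h i)) subnKC //.
  by case: eqP => [<-|_]; rewrite ?mul1n.
case: mu => [|k mu] //= /andP[/eqP[sm] /forallP h]; exists k.
  by rewrite -[_ \in _]/(k \in iota 0 (n g).+1) mem_iota ltnS /= -(eqP (h g)) eqxx mul1n leq_addr.
apply/mapP; exists mu => //; rewrite IH sm eqxx; apply/forallP => i.
by rewrite -(eqP (h i)) addKn.
Qed.

Lemma memmonsP gs n mu :
  reflect (size mu = size gs /\ forall i, degm gs mu i = n i) (mu \in mons gs n).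
Proof.
rewrite mem_mons; apply: (iffP andP) => [[/eqP ? /forallP h]|[-> h]].
  by split=> // i; apply/eqP.
by split=> //; apply/forallP => i; rewrite h.
Qed.

Lemma mons_pairwise gs n : pairwise lexm (mons gs n).
Proof.
elim: gs n => [|g gs IH] n; first by rewrite /=; case: ifP.
rewrite mons_cons; elim: (n g).+1 0%N => [|l IHl] a //=; rewrite pairwise_cat IHl andbT.
apply/andP; split.
  apply/allrelP => _ y /mapP[x _ ->] /flatten_mapP[k]; rewrite mem_iota => /andP[ak _].
  by case/mapP=> z _ -> /=; rewrite ak.
rewrite pairwise_map; apply: sub_pairwise (IH _) => x y /= ->.
by rewrite eqxx orbT.
Qed.

(** Sortedness identifies initial segments of the list with lexicographic ones; this turns
    [lower_span] into the span of a prefix. *)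
Lemma mons_prefix gs n s1 mu s2 nu : mons gs n = s1 ++ mu :: s2 ->
  (nu \in s1) = (nu \in mons gs n) && lexm nu mu.
Proof.
move=> E; have := mons_pairwise gs n; rewrite {}E pairwise_cat /= allrel_consr.
move=> /and4P[/andP[/allP h1 _] _ /allP h2 _].
rewrite mem_cat inE; apply/idP/andP => [n1|[/or3P[//|/eqP->|n2]]].
- by rewrite n1; split=> //; apply: h1.
- by rewrite lexm_irr.
- by rewrite (lexm_asym (h2 _ n2)).
Qed.

Variable R : comNzRingType.
Variables (gs : seq G) (ys : seq R).
Hypothesis sys : size ys = size gs.

Fixpoint mon (ys : seq R) (mu : seq nat) : R :=
  match ys, mu with
  | y :: ys', k :: mu' => y ^+ k * mon ys' mu'
  | _, _ => 1
  end.

Lemma mon_madd (zs : seq R) a b : size a = size zs -> size b = size zs ->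
  mon zs (madd a b) = mon zs a * mon zs b.
Proof.
elim: zs a b => [|y zs IH] [|k a] [|l b] //=; rewrite ?mulr1 // => -[sa] [sb].
by rewrite IH // exprD mulrACA.
Qed.

Lemma mon_nseq0 (zs : seq R) k : mon zs (nseq k 0%N) = 1.
Proof. by elim: zs k => [|y zs IH] [|k] //=; rewrite IH mulr1. Qed.

Lemma mon_unitm (zs : seq R) j : (j < size zs)%N -> mon zs (unitm (size zs) j) = nth 0 zs j.
Proof.
elim: zs j => [|y zs IH] [|j] //=; first by rewrite mon_nseq0 mulr1.
by rewrite ltnS => /IH ->; rewrite mul1r.
Qed.

Definition mon_span n : R -> Prop := ideal_span (fun x =>
  exists nu, [/\ size nu = size gs, (forall i, degm gs nu i = n i) & x = mon ys nu]).

Definition lower_span mu : R -> Prop := ideal_span (fun x =>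
  exists nu, [/\ size nu = size gs, lexm nu mu, (forall i, degm gs nu i = degm gs mu i)
               & x = mon ys nu]).

Definition list_span (s : seq (seq nat)) : R -> Prop :=
  ideal_span (fun x => exists2 nu, nu \in s & x = mon ys nu).

Lemma mon_span_is_ideal n : is_ideal (mon_span n). Proof. exact: span_is_ideal. Qed.

Lemma lower_span_is_ideal mu : is_ideal (lower_span mu). Proof. exact: span_is_ideal. Qed.

Lemma list_span_is_ideal s : is_ideal (list_span s). Proof. exact: span_is_ideal. Qed.

#[local] Hint Resolve mon_span_is_ideal lower_span_is_ideal list_span_is_ideal : core.

Lemma mon_span_list n : mon_span n = list_span (mons gs n).
Proof.
apply: sub_ideal_antisym; apply: span_sub => x.
  by move=> [nu [? ? ->]]; exists nu => //; apply/memmonsP.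
by move=> [nu /memmonsP [? ?] ->]; exists nu.
Qed.

Lemma lower_span_list n s1 mu s2 : mons gs n = s1 ++ mu :: s2 ->
  lower_span mu = list_span s1.
Proof.
move=> E; have /memmonsP[smu dmu] : mu \in mons gs n by rewrite E mem_cat mem_head orbT.
apply: sub_ideal_antisym; apply: span_sub => x.
  move=> [nu [snu nm dnu ->]]; exists nu => //; rewrite (mons_prefix _ E) nm andbT.
  by apply/memmonsP; split=> // i; rewrite dnu.
move=> [nu + ->]; rewrite (mons_prefix _ E) => /andP[/memmonsP [snu dnu] nm].
by exists nu; split=> // i; rewrite dnu dmu.
Qed.

Lemma list_span_rcons s mu :
  list_span (rcons s mu) = ideal_add (list_span s) (principal (mon ys mu)).
Proof.
apply: sub_ideal_antisym.
  apply: span_min; first exact: add_is_ideal.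
  move=> _ [nu + ->]; rewrite mem_rcons inE => /predU1P[->|ns].
    by apply: mem_add_principal; apply: span_is_ideal.
  by apply: add_subl; [apply: principal_is_ideal | apply: mem_span; exists nu].
apply: add_principal_min; first exact: span_is_ideal.
  by apply: span_sub => x [nu ns ->]; exists nu => //; rewrite mem_rcons inE ns orbT.
by apply: mem_span; exists mu => //; rewrite mem_rcons mem_head.
Qed.

(** The order is compatible with multiplication of monomials, and multidegree is additive. *)
Lemma lower_span_mul mu gam b : size mu = size gs -> size gam = size gs ->
  lower_span mu b -> lower_span (madd mu gam) (mon ys gam * b).
Proof.
move=> smu sgam; apply: span_mulr; first exact: span_is_ideal.
move=> _ [nu [snu nm dnu ->]]; apply: mem_span; exists (madd nu gam).
rewrite size_madd ?snu // lexm_add2r ?snu ?smu ?sgam //; split=> //.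
  by move=> i; rewrite !degm_madd // dnu.
by rewrite mon_madd ?sys // mulrC.
Qed.

(** * Leading coefficient ideals *)

Section Lead.
(** [P] plays the part of a graded module over the polynomial ring whose variables map to [ys]. *)
Variable P : (G -> nat) -> R -> Prop.
Hypothesis iP : forall n, is_ideal (P n).
Hypothesis mP : forall gam n x, size gam = size gs -> P n x ->
  P (fun i => n i + degm gs gam i)%N (mon ys gam * x).

(* The coefficients of [mu] in the elements of [P] whose leading exponent is at most [mu]. *)
Definition lead mu : R -> Prop := fun c =>
  exists2 b, lower_span mu b & P (degm gs mu) (c * mon ys mu + b).

Lemma lead_is_ideal mu : is_ideal (lead mu).
Proof.
have iL : is_ideal (lower_span mu) by apply: span_is_ideal.
split; first by exists 0; [apply: ideal0 | rewrite mul0r add0r; apply: ideal0].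
split.
  move=> c c' [b Lb Pb] [b' Lb' Pb']; exists (b + b'); first exact: idealD.
  by rewrite mulrDl addrACA; apply: idealD.
move=> a c [b Lb Pb]; exists (a * b); first exact: ideal_absorbl.
by rewrite -mulrA -mulrDr; apply: ideal_absorbl.
Qed.

(** If [b] is [a] plus [gam], multiplying a witness for [a] by the monomial of [gam] gives one for
    [b]. *)
Lemma lead_mono a b : size a = size gs -> leqm a b -> sub_ideal (lead a) (lead b).
Proof.
move=> sa /leqm_madd [gam sg ->] c [x Lx Px]; rewrite sa in sg.
exists (mon ys gam * x); first exact: lower_span_mul.
have -> : degm gs (madd a gam) = (fun i => degm gs a i + degm gs gam i)%N.
  by apply: functional_extensionality => i; rewrite degm_madd.
rewrite mon_madd ?sys //.
have -> : c * (mon ys a * mon ys gam) + mon ys gam * x = mon ys gam * (c * mon ys a + x) by ring.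
exact: mP.
Qed.

Lemma lead_stable : noetherian R -> exists c, forall c' mu, (c <= c')%N ->
  size mu = size gs -> sub_ideal (lead mu) (lead (truncm c' mu)).
Proof.
move=> noeR; apply: monotone_stable => // [mu _|a b]; first exact: lead_is_ideal.
exact: lead_mono.
Qed.

(* Subtracting multiples of elements of [P] of bounded degree, every element of [P] is reduced
   to zero: this replaces the finite generation of [P] over the Rees algebra. *)
Lemma lead_reduction (K : R -> Prop) n c : is_ideal K ->
  (forall mu, size mu = size gs -> sub_ideal (lead mu) (lead (truncm c mu))) ->
  (forall a gam x, size a = size gs -> size gam = size gs -> all (leq^~ c) a ->
     (forall i, degm gs a i + degm gs gam i = n i)%N -> P (degm gs a) x -> K (mon ys gam * x)) ->
  sub_ideal (ideal_cap (P n) (mon_span n)) K.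
Proof.
move=> iK stab hK x [Px]; rewrite mon_span_list.
(* Induction on the prefix [s1] of monomials still allowed; its last entry is the leading one. *)
suff h s1 s2 y : mons gs n = s1 ++ s2 -> P n y -> list_span s1 y -> K y.
  by apply: (h _ [::]); rewrite ?cats0.
elim/last_ind: s1 s2 y => [|s1 mu IH] s2 y E Py.
  by apply: span_min => // ? [].
rewrite list_span_rcons => -[b [_ [sb [[d ->] yE]]]].
rewrite cat_rcons in E; have lE := lower_span_list E.
have /memmonsP[smu dmu] : mu \in mons gs n by rewrite E mem_cat mem_head orbT.
have dE : degm gs mu = n by apply: functional_extensionality.
have [b' Lb' Pb'] : lead (truncm c mu) d.
  by apply: stab => //; exists b; rewrite ?lE // dE addrC -yE.
have [gam sg muE] := leqm_madd (leqm_trunc c mu).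
rewrite size_truncm smu in sg; have st : size (truncm c mu) = size gs by rewrite size_truncm.
set z := d * mon ys (truncm c mu) + b' in Pb'.
have dd i : (degm gs (truncm c mu) i + degm gs gam i = n i)%N by rewrite -dmu [in RHS]muE degm_madd.
have -> : y = mon ys gam * z + (y - mon ys gam * z) by rewrite addrC subrK.
apply: idealD => //.
  by apply: hK dd Pb' => //; apply/allP => k /mapP[l _ ->]; apply: geq_minr.
apply: (IH (mu :: s2)) => //.
  apply: idealB => //; have -> : n = (fun i => degm gs (truncm c mu) i + degm gs gam i)%N.
    by apply: functional_extensionality.
  exact: mP.
(* The leading terms cancel, so the difference only involves smaller monomials. *)
have -> : y - mon ys gam * z = b - mon ys gam * b'.
  by rewrite yE [in mon ys mu]muE mon_madd ?sys // /z; ring.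
apply: idealB => //.
by rewrite -lE [in lower_span _]muE; apply: lower_span_mul.
Qed.

End Lead.

(** * Products of powers as spans of monomials *)

Section Ideals.
Variable A : G -> R -> Prop.
Hypothesis AE : forall i, A i = ideal_span (fun x =>
  exists j, [/\ (j < size gs)%N, nth i gs j = i & x = nth 0 ys j]).

(** A monomial of positive degree in [i] contains a variable labelled [i], hence splits off a
    generator of [A i]. *)
Lemma mon_span_mul i n :
  ideal_mul (A i) (mon_span n) = mon_span (fun k => (i == k) + n k)%N.
Proof.
apply: sub_ideal_antisym.
  have iM := @mon_span_is_ideal (fun k => (i == k) + n k)%N.
  apply: mul_min => // a b; rewrite AE => ha hb; rewrite mulrC; move: ha.
  apply: span_mulr => // _ [j [js ji ->]]; rewrite mulrC; move: hb; apply: span_mulr => //.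
  move=> _ [nu [sn dn ->]]; apply: mem_span; exists (madd (unitm (size gs) j) nu).
  rewrite size_madd size_unitm //; split=> // [k|].
    by rewrite degm_madd ?size_unitm // (degm_unitm _ i) // ji dn.
  by rewrite mon_madd ?size_unitm ?sys // -sys mon_unitm // sys.
have iA : is_ideal (A i) by rewrite AE; apply: span_is_ideal.
apply: span_min; first exact: mul_is_ideal.
move=> _ [nu [sn dn ->]].
have [|j [js ji jn]] := @degm_gt0 gs nu i sn; first by rewrite dn eqxx.
have [b sb nE] := unitm_factor jn; rewrite sn in sb nE.
rewrite nE maddC mon_madd ?size_unitm ?sys //; apply: mem_mul.
  by rewrite AE; apply: mem_span; exists j; rewrite -sys mon_unitm // sys.
apply: mem_span; exists b; split=> // k; have := dn k.
by rewrite nE degm_madd ?size_unitm // (degm_unitm _ i) // ji addnC => /addnI.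
Qed.

Lemma mon_span_exp i e n :
  ideal_mul (ideal_exp (A i) e) (mon_span n) = mon_span (fun k => (i == k) * e + n k)%N.
Proof.
have iA : is_ideal (A i) by rewrite AE; apply: span_is_ideal.
elim: e => [|e IH].
  rewrite ideal_mul1l; last exact: mon_span_is_ideal.
  by congr mon_span; apply: functional_extensionality => k; rewrite muln0.
rewrite ideal_expS -ideal_mulA //; last exact: exp_is_ideal.
rewrite IH mon_span_mul; congr mon_span; apply: functional_extensionality => k.
by rewrite mulnS addnA.
Qed.

Lemma mon_span0 : mon_span (fun=> 0%N) = @unit_ideal R.
Proof.
apply: sub_ideal_antisym => // x _; apply: ideal1; first exact: mon_span_is_ideal.
apply: mem_span; exists (nseq (size gs) 0%N); rewrite size_nseq mon_nseq0.
by split=> // i; rewrite degm_nseq0.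
Qed.

Lemma mon_span_prods n (s : seq G) : uniq s ->
  foldr (fun i acc => ideal_mul (ideal_exp (A i) (n i)) acc) (@unit_ideal R) s =
  mon_span (fun i => (i \in s) * n i)%N.
Proof.
elim: s => [|i s IH] /=; first by rewrite -mon_span0.
move=> /andP[nis us]; rewrite IH // mon_span_exp; congr mon_span.
apply: functional_extensionality => k; rewrite inE (eq_sym k).
by case: eqP => [<-|_] /=; rewrite ?(negPf nis) ?mul1n ?mul0n ?addn0.
Qed.

End Ideals.

End Degree.

#[local] Hint Resolve mon_span_is_ideal lower_span_is_ideal list_span_is_ideal : core.

Lemma nth_unzip (T : eqType) (R : comNzRingType) (ps : seq (T * R)) i x :
  (exists j, [/\ (j < size (unzip1 ps))%N, nth i (unzip1 ps) j = i & x = nth 0 (unzip2 ps) j])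
  <-> (i, x) \in ps.
Proof.
rewrite size_map; split=> [[j [js ji ->]]|/(nthP (i, 0)) [j js jE]].
  apply/(nthP (i, 0)); exists j => //.
  rewrite [LHS]surjective_pairing -(nth_map _ i fst) // -(nth_map _ 0 snd) //.
  by congr pair.
by exists j; rewrite js (nth_map (i, 0)) // (nth_map (i, 0)) // jE.
Qed.

Lemma span_unzip (T : eqType) (R : comNzRingType) (ps : seq (T * R)) i :
  ideal_span (fun x => (i, x) \in ps) = ideal_span (fun x => exists j,
    [/\ (j < size (unzip1 ps))%N, nth i (unzip1 ps) j = i & x = nth 0 (unzip2 ps) j]).
Proof. by apply: sub_ideal_antisym; apply: span_sub => x; rewrite nth_unzip. Qed.

Lemma mem_dep_pairs (T : finType) (R : comNzRingType) (s : T -> seq R) i x :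
  ((i, x) \in [seq (k, y) | k <- enum T, y <- s k]) = (x \in s i).
Proof.
apply/allpairsPdep/idP => [[k [y [_ ys [-> ->]]]] //|xs].
by exists i, x; rewrite mem_enum.
Qed.

Lemma ideals_fg (T : finType) (R : comNzRingType) (A : T -> R -> Prop) : noetherian R ->
  (forall i, is_ideal (A i)) ->
  exists ps : seq (T * R), forall i, A i = ideal_span (fun x => (i, x) \in ps).
Proof.
move=> noeR iA; have [s hs] := fin_all_exists (fun i => ideal_fg noeR (iA i)).
exists [seq (k, y) | k <- enum T, y <- s k] => i; rewrite hs.
by congr ideal_span; apply: functional_extensionality => x; rewrite mem_dep_pairs.
Qed.

(** * The Artin-Rees lemma *)

Section ArtinRees.
Variable R : comNzRingType.
Hypothesis noeR : noetherian R.
Variables m A : R -> Prop.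
Hypotheses (im : is_ideal m) (iA : is_ideal A).

(** Apply [lead_reduction] to generators of [m] (label [true]) and [A] (label [false]). The family
    [P] carries one factor of [A] more than its degree shows, and multiplication by a monomial keeps
    this extra factor. *)
Lemma artin_rees_step : exists k, forall N s,
  sub_ideal (ideal_cap (ideal_exp A s.+1) (ideal_mul (ideal_exp m N) (ideal_exp A s)))
            (ideal_mul (ideal_exp m (N - k)) (ideal_exp A s.+1)).
Proof.
pose F (i : bool) := if i then m else A.
have iF i : is_ideal (F i) by case: i.
have [ps FE] := ideals_fg noeR iF.
set gs := unzip1 ps; set ys := unzip2 ps.
have sys : size ys = size gs by rewrite !size_map.
have im' N : is_ideal (ideal_exp m N) by apply: exp_is_ideal.
have iA' N : is_ideal (ideal_exp A N) by apply: exp_is_ideal.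
have WE n : mon_span gs ys n = ideal_mul (ideal_exp m (n true)) (ideal_exp A (n false)).
  have /(_ n [:: true; false] isT) := mon_span_prods sys (fun i => etrans (FE i) (span_unzip ps i)).
  rewrite /= (ideal_mulC (ideal_exp A _)) ideal_mul1l // => ->.
  by congr mon_span; apply: functional_extensionality => -[]; rewrite mul1n.
have memW gam : size gam = size gs -> mon_span gs ys (degm gs gam) (mon ys gam).
  by move=> sg; apply: mem_span; exists gam.
pose P (n : bool -> nat) := ideal_cap (ideal_exp A (n false).+1)
  (ideal_mul (ideal_exp m (n true)) (ideal_exp A (n false))).
have iP n : is_ideal (P n) by apply: cap_is_ideal => //; apply: mul_is_ideal.
have memA gam n x : size gam = size gs -> ideal_exp A n.+1 x ->
    ideal_mul (ideal_exp m (degm gs gam true)) (ideal_exp A (degm gs gam false + n).+1)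
      (mon ys gam * x).
  move=> /memW; rewrite WE -addnS => h1 h2; rewrite ideal_expD // ideal_mulA //.
  exact: mem_mul.
have mP gam n x : size gam = size gs -> P n x ->
    P (fun i => n i + degm gs gam i)%N (mon ys gam * x).
  move=> sg [Ax mx]; split.
    by rewrite addnC; apply: mul_subr (memA _ _ _ sg Ax).
  rewrite addnC [X in ideal_exp A X]addnC !ideal_expD // ideal_mulACA //.
  by apply: mem_mul => //; rewrite -WE; apply: memW.
have [c hc] := lead_stable sys iP mP noeR.
(* The exponents in [a] are at most [c] for each of the [size gs] variables, so [gam] keeps degree
   at least [N - size gs * c] in [m]. *)
exists (size gs * c)%N => N s x [Ax mx].
pose n (i : bool) := if i then N else s.
apply: (lead_reduction sys iP mP (n := n) _ (fun mu => hc c mu (leqnn c))).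
- exact: mul_is_ideal.
- move=> a gam y sa sg ac dd [Ay _]; have := memA _ _ _ sg Ay.
  have := dd true; have := dd false; rewrite /n addnC => <- E.
  apply: mul_sub => //; apply: exp_anti => //.
  have := degm_leq_sum gs true ac; lia.
- by split; [split | rewrite WE].
Qed.

(** Each use of the step raises the power of [A] by one at the cost of [k] in the power of [m]. *)
Lemma artin_rees : exists k, forall N s,
  sub_ideal (ideal_cap (ideal_exp m N) (ideal_exp A s))
            (ideal_mul (ideal_exp m (N - k * s)) (ideal_exp A s)).
Proof.
have [k hk] := artin_rees_step; exists k => N; elim=> [|s IH] x [mx Ax].
  by rewrite muln0 subn0 ideal_mulC ideal_mul1l //; apply: exp_is_ideal.
rewrite mulnS addnC subnDA; apply: hk; split=> //; apply: IH; split=> //.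
exact: (exp_anti iA (leqnSn s)).
Qed.

Lemma exp_cap_sub B K : is_ideal B -> sub_ideal (ideal_mul (ideal_exp m K) A) B ->
  exists c, forall s, sub_ideal (ideal_cap (ideal_exp m (c * s)) (ideal_exp A s)) (ideal_exp B s).
Proof.
(* With [c = K + k], Artin-Rees leaves [m^(K s) A^s], the [s]-th power of [m^K A]. *)
move=> iB mAB; have [k hk] := artin_rees; exists (K + k)%N => s.
apply: sub_ideal_trans (hk _ _) _.
rewrite -mulnBl addnK ideal_expM // -ideal_expMn //; last exact: exp_is_ideal.
exact: exp_sub.
Qed.

End ArtinRees.

(** * The length of [J^n / I^n] *)

Section Products.
Variables (R : comNzRingType) (r d : nat) (I J : 'I_r -> R -> Prop) (m : R -> Prop).
Hypotheses (noeR : noetherian R) (mmax : maximal_ideal m).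
Hypothesis muniq : forall M, maximal_ideal M -> (forall x, M x <-> m x).
Hypotheses (iI : forall i, is_ideal (I i)) (iJ : forall i, is_ideal (J i)).
Hypothesis IJ : forall i, sub_ideal (I i) (J i).
Hypothesis lIJ : forall i, exists l, length_eq (I i) (J i) l.

Let im : is_ideal m := max_is_ideal mmax.

Lemma prod_exp_is_ideal (A : 'I_r -> R -> Prop) n : (forall i, is_ideal (A i)) ->
  is_ideal (ideal_prod_exp A n).
Proof.
move=> iA; rewrite /ideal_prod_exp; elim: (enum _) => //= i s IH.
by apply: mul_is_ideal; apply: exp_is_ideal.
Qed.

Lemma max_exp_mul_uniform : exists K, forall i,
  sub_ideal (ideal_mul (ideal_exp m K) (J i)) (I i).
Proof.
(* The length of [J i / I i] is a valid exponent for [i], and the sum dominates them all. *)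
have [l hl] := fin_all_exists lIJ; exists (\sum_i l i)%N => i.
have := max_exp_mul_sub noeR mmax muniq (iI i) (iJ i) (@IJ i) (hl i).
apply: sub_ideal_trans; apply: mul_sub => //; apply: exp_anti => //.
by rewrite (bigD1 i) //= leq_addr.
Qed.

Lemma max_exp_mul_prod : exists K, sub_ideal
  (ideal_mul (ideal_exp m K) (ideal_prod_exp J (fun=> 1%N))) (ideal_prod_exp I (fun=> 1%N)).
Proof.
have [K hK] := max_exp_mul_uniform.
rewrite /ideal_prod_exp; elim: (enum _) => [|i s [K' IH]] /=; first by exists 0%N.
pose f (A : 'I_r -> R -> Prop) :=
  foldr (fun i acc => ideal_mul (ideal_exp (A i) 1) acc) (@unit_ideal R) s.
have i_f A : (forall i, is_ideal (A i)) -> is_ideal (f A).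
  by move=> iA; rewrite /f; elim: (s) => //= k t ?; apply: mul_is_ideal; apply: mul_is_ideal.
exists (K + K')%N.
rewrite ![ideal_mul (_ i) (@unit_ideal R)]ideal_mulC !ideal_mul1l //.
rewrite ideal_expD // ideal_mulACA //; [|exact: exp_is_ideal|exact: exp_is_ideal|exact: (i_f J)].
exact: mul_sub.
Qed.

Lemma diagonal_growth : ~ has_prime_chain R d.+1 ->
  exists C, forall s l,
    has_chain_between (ideal_prod_exp I (fun=> s)) (ideal_prod_exp J (fun=> s)) l ->
    (l <= C * s ^ d)%N.
Proof.
move=> nch; have [k hk] := max_exp_growth noeR mmax muniq nch.
have [K hK] := max_exp_mul_prod.
have [c hc] := exp_cap_sub noeR im (prod_exp_is_ideal _ iJ) (prod_exp_is_ideal _ iI) hK.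
(* The bound is [(c s)^d k]: adding [m^(c s)] to the members of a chain keeps its steps strict. *)
exists (c ^ d * k)%N => s l; rewrite (prod_exp_const s iI) (prod_exp_const s iJ) => hl.
rewrite mulnAC -expnMn leqNgt; apply/negP => lt; apply: (hk (c * s)%N).
apply: (chain_leq lt); move: hl; apply: chain_add; last exact: hc.
- exact/exp_is_ideal/prod_exp_is_ideal.
- exact/exp_is_ideal/prod_exp_is_ideal.
- exact: exp_is_ideal.
Qed.

(** The first [p] variables will be the [z]; monomials failing this test involve the [y] alone and
    span [I^n]. *)
Definition has_pos p (mu : seq nat) := has (leq 1) (take p mu).

Lemma has_pos_lexm p nu mu : size nu = size mu -> ~~ has_pos p nu -> has_pos p mu -> lexm nu mu.
Proof.
rewrite /has_pos; elim: p nu mu => [|p IH] [|x nu] [|y mu] //= [sn].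
rewrite negb_or -eqn0Ngt => /andP[/eqP-> h]; case: (posnP y) => [->|_] //=.
exact: IH.
Qed.

Lemma has_pos_trunc p c mu : (0 < c)%N -> has_pos p (truncm c mu) = has_pos p mu.
Proof.
move=> c0; rewrite /has_pos /truncm -map_take has_map; apply: eq_has => k /=.
by rewrite leq_min c0 andbT.
Qed.

Lemma not_has_pos p mu : (p <= size mu)%N -> ~~ has_pos p mu -> mu = nseq p 0%N ++ drop p mu.
Proof.
move=> pm np; rewrite -{1}(cat_take_drop p mu); congr (_ ++ _).
rewrite -[in RHS](size_takel pm); apply/all_pred1P; move: np; rewrite /has_pos -all_predC.
by apply: sub_all => k /=; rewrite -eqn0Ngt.
Qed.

Lemma degm_cat0 (G : finType) (gz gy : seq G) nu i :
  degm (gz ++ gy) (nseq (size gz) 0%N ++ nu) i = degm gy nu i.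
Proof. by elim: gz => //= g gz ->; rewrite muln0. Qed.

Lemma mon_cat0 (zs xs : seq R) nu : mon (zs ++ xs) (nseq (size zs) 0%N ++ nu) = mon xs nu.
Proof. by elim: zs => //= z zs ->; rewrite mul1r. Qed.

Theorem length_prod_exp : exists (gs : seq 'I_r) (phi : seq nat -> nat) (c : nat),
  (forall mu, size mu = size gs -> phi mu = phi (truncm c mu)) /\
  forall n, length_eq (ideal_prod_exp I n) (ideal_prod_exp J n) (\sum_(mu <- mons gs n) phi mu).
Proof.
have [pz JE] := ideals_fg noeR iJ; have [py IE] := ideals_fg noeR iI.
pose p := size pz; pose gs := unzip1 (pz ++ py); pose ys := unzip2 (pz ++ py).
have sgs : size gs = (p + size py)%N by rewrite size_map size_cat.
have sys : size ys = size gs by rewrite !size_map.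
(* For the zero family the leading coefficient condition reads [c mu + b = 0], so [L mu] is the
   colon of [lower_span mu] by the monomial [mu]. *)
pose P (n : 'I_r -> nat) (x : R) := x = 0.
have iP n : is_ideal (P n).
  split=> //; split=> [x y -> ->|a x ->]; first by rewrite /P addr0.
  by rewrite /P mulr0.
have mP gam n x : size gam = size gs -> P n x ->
    P (fun i => n i + degm gs gam i)%N (mon ys gam * x) by move=> _ ->; rewrite /P mulr0.
pose L := lead gs ys P.
have LE mu : L mu = colon (lower_span gs ys mu) (mon ys mu).
  rewrite /colon; apply: sub_ideal_antisym => c => [[b Lb] /eqP|Lc].
    by rewrite addr_eq0 => /eqP->; apply: idealN.
  by exists (- (c * mon ys mu)); [apply: idealN | apply: subrr].
(* Generators of [I i] may be added to those of [J i], so the monomials in all variables span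
   [J^n]. *)
have JE' i : J i = ideal_span (fun x => (i, x) \in pz ++ py).
  rewrite JE; apply: sub_ideal_antisym; first by apply: span_sub => x; rewrite mem_cat => ->.
  apply: span_min => // x; rewrite mem_cat => /orP[xz|xy]; first by apply: mem_span.
  by rewrite -JE; apply: IJ; rewrite IE; apply: mem_span.
have [K hK] := max_exp_mul_uniform.
(* Split one [z] off [mu]. An element of [m^K] times this [z] lies in [I i], and expanding it in the
   [y] replaces [z] by later variables with the same label. *)
have mL mu : size mu = size gs -> has_pos p mu -> sub_ideal (ideal_exp m K) (L mu).
  move=> smu hp a ma; rewrite LE /colon.
  have [j [jp jm]] : exists j, (j < p)%N /\ (0 < nth 0 mu j)%N.
    have /(has_nthP 0) [j] := hp; rewrite size_takel; last by rewrite smu sgs leq_addr.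
    by move=> jp; rewrite nth_take // => jm; exists j.
  have [nu snu muE] := unitm_factor jm; rewrite smu in snu muE.
  have jgs : (j < size gs)%N by rewrite sgs (leq_trans jp) // leq_addr.
  have [i [gi zi]] : exists i, nth i gs j = i /\ (i, nth 0 ys j) \in pz.
    have [x0 _] : exists x0, x0 \in pz.
      by move: jp; rewrite /p; case: (pz) => // x0 t _; exists x0; apply: mem_head.
    have jp' : (j < size (pz ++ py))%N by rewrite size_cat -/p -sgs.
    have nE : nth x0 (pz ++ py) j = nth x0 pz j by rewrite nth_cat jp.
    exists (nth x0 pz j).1; rewrite /gs /ys (nth_map x0) // (nth_map x0) // nE.
    by rewrite -surjective_pairing mem_nth.
  have -> : a * mon ys mu = mon ys nu * (a * nth 0 ys j).
    by rewrite muE mon_madd ?size_unitm ?sys // -sys mon_unitm ?sys // mulrCA.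
  have : I i (a * nth 0 ys j).
    by apply: hK; apply: mem_mul => //; rewrite JE; apply: mem_span.
  rewrite IE; apply: span_mulr => // x /(nthP (i, 0)) [l lp lE].
  have lgs : (p + l < size gs)%N by rewrite sgs ltn_add2l.
  have lgs' : (p + l < size (pz ++ py))%N by rewrite size_cat ltn_add2l.
  have nE : nth (i, 0) (pz ++ py) (p + l) = (i, x).
    by rewrite nth_cat -/p ltnNge leq_addr /= addKn.
  have gl : nth i gs (p + l) = i by rewrite /gs (nth_map (i, 0)) // nE.
  have yl : nth 0 ys (p + l) = x by rewrite /ys (nth_map (i, 0)) // nE.
  apply: mem_span; exists (madd nu (unitm (size gs) (p + l))).
  rewrite size_madd ?size_unitm // muE; split=> // [|k|].
  - rewrite maddC [X in lexm _ X]maddC lexm_add2r ?size_unitm ?snu // lexm_unitm // lgs andbT.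
    exact: leq_trans jp (leq_addr _ _).
  - by rewrite !degm_madd ?size_unitm // !(degm_unitm _ i) // gi gl.
  - by rewrite mon_madd ?size_unitm ?sys // -sys mon_unitm ?sys // yl.
have [h hh] : exists h : seq nat -> nat, forall mu, size mu = size gs -> has_pos p mu ->
    length_eq (L mu) (@unit_ideal R) (h mu).
  have [k nk] := no_chain_max_exp noeR mmax K.
  have ex mu : exists l, size mu = size gs -> has_pos p mu -> length_eq (L mu) (@unit_ideal R) l.
    case: (classic (size mu = size gs /\ has_pos p mu)) => [[smu hp]|nh]; last first.
      by exists 0%N => smu hp; case: nh.
    have [|hc|l hl] := @bounded_length _ (L mu) (@unit_ideal R) k (lead_is_ideal _ _ iP mu); by
      [| apply: nk; apply: chain_sub hc => //; apply: mL | exists l].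
  pose h mu := proj1_sig (constructive_indefinite_description _ (ex mu)).
  exists h => mu; rewrite /h; case: constructive_indefinite_description => l /=; exact.
have [c hc] := lead_stable sys iP mP noeR.
(* The bound is [c.+1] because truncation at a positive number does not affect [has_pos]. *)
exists gs, (fun mu => if has_pos p mu then h mu else 0%N), c.+1; split=> [mu smu|n].
  rewrite has_pos_trunc //; case: ifP => // hp.
  have st : size (truncm c.+1 mu) = size gs by rewrite size_truncm.
  have hpt : has_pos p (truncm c.+1 mu) by rewrite has_pos_trunc.
  have LEt : L mu = L (truncm c.+1 mu).
    apply: sub_ideal_antisym; first exact: hc.
    by apply: (lead_mono sys mP) => //; apply: leqm_trunc.
  by apply: length_eq_uniq (hh _ smu hp) _; rewrite LEt; apply: hh.
set pure := [seq nu <- mons gs n | ~~ has_pos p nu].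
have spanE (s t : seq (seq nat)) : s =i t -> list_span ys s = list_span ys t.
  by move=> st; apply: sub_ideal_antisym; apply: span_sub => x [nu ns ->]; exists nu;
    rewrite // ?st // -st.
have enE (A : 'I_r -> R -> Prop) (ps : seq ('I_r * R)) :
    (forall i, A i = ideal_span (fun x => (i, x) \in ps)) ->
    ideal_prod_exp A n = mon_span (unzip1 ps) (unzip2 ps) n.
  move=> AE; have sps : size (unzip2 ps) = size (unzip1 ps) by rewrite !size_map.
  rewrite /ideal_prod_exp (mon_span_prods sps (fun i => etrans (AE i) (span_unzip ps i))).
    by congr mon_span; apply: functional_extensionality => i; rewrite mem_enum mul1n.
  exact: enum_uniq.
have IP : ideal_prod_exp I n = list_span ys pure.
  have pE : size (unzip1 pz) = p by rewrite size_map.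
  have pE' : size (unzip2 pz) = p by rewrite size_map.
  have gsE : gs = unzip1 pz ++ unzip1 py by rewrite /gs /unzip1 map_cat.
  have ysE : ys = unzip2 pz ++ unzip2 py by rewrite /ys /unzip2 map_cat.
  rewrite (enE _ _ IE); apply: sub_ideal_antisym; apply: span_sub => x.
    move=> [nu [snu dnu ->]]; exists (nseq p 0%N ++ nu); last by rewrite ysE -pE' mon_cat0.
    rewrite mem_filter {1}/has_pos take_size_cat ?size_nseq // has_nseq andbF /=.
    apply/memmonsP; rewrite size_cat size_nseq snu sgs size_map; split=> // i.
    by rewrite gsE -pE degm_cat0.
  move=> [nu]; rewrite mem_filter => /andP[np /memmonsP [snu dnu]] ->.
  have nuE := not_has_pos (p := p) _ np; exists (drop p nu); split.
  - by rewrite size_drop snu sgs addKn size_map.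
  - move=> i; rewrite -dnu [in RHS]nuE ?snu ?sgs ?leq_addr // gsE -pE degm_cat0 //.
  - by rewrite {1}nuE ?snu ?sgs ?leq_addr // ysE -{1}pE' mon_cat0.
(* Repetitions in this list do not affect the span; putting [pure] in front makes [I^n] the start of
   the filtration. *)
have JP : ideal_prod_exp J n = list_span ys (pure ++ mons gs n).
  rewrite (enE _ _ JE') mon_span_list; apply: spanE => nu.
  by rewrite mem_cat mem_filter; case: (nu \in mons _ _); rewrite ?andbF ?orbT.
rewrite IP JP.
suff step s1 s2 : mons gs n = s1 ++ s2 -> length_eq (list_span ys pure) (list_span ys (pure ++ s1))
    (\sum_(mu <- s1) if has_pos p mu then h mu else 0%N).
  by apply: (step _ [::]); rewrite cats0.
elim/last_ind: s1 s2 => [|s1 mu IH] s2 E.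
  by rewrite cats0 big_nil; apply: length_eq_refl.
rewrite cat_rcons in E; have {}IH := IH _ E.
have mmu : mu \in mons gs n by rewrite E mem_cat mem_head orbT.
have [smu dmu] := memmonsP _ _ _ mmu.
rewrite -[in X in length_eq _ _ X]cats1 big_cat big_seq1 /=.
(* A monomial in the [y] alone already lies in the starting ideal and contributes nothing. *)
case: ifP => [hp|/negbT np]; last first.
  rewrite addn0; suff <- : list_span ys (pure ++ s1) = list_span ys (pure ++ rcons s1 mu) by [].
  apply: spanE => nu; rewrite !mem_cat mem_rcons inE.
  by case: eqP => [->|//]; rewrite /= mem_filter np mmu.
(* All of [pure] precedes [mu], so adjoining it to the prefix [s1] changes nothing. *)
have s1E : list_span ys (pure ++ s1) = lower_span gs ys mu.
  rewrite (lower_span_list _ E); apply: spanE => nu; rewrite mem_cat (mons_prefix _ E) mem_filter.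
  case: (boolP (nu \in mons gs n)) => [|_]; last by rewrite andbF.
  case/memmonsP=> snu _; rewrite andbT /=.
  case: (boolP (has_pos p nu)) => //= npn.
  by rewrite (has_pos_lexm _ npn hp) // snu smu.
have rE : list_span ys (pure ++ rcons s1 mu) =
    ideal_add (list_span ys (pure ++ s1)) (principal (mon ys mu)).
  by rewrite -rcons_cat list_span_rcons.
rewrite rE; apply: (length_eqD _ _ _ _ _ IH) => //; try exact: add_is_ideal.
- by apply: span_sub => x [nu nupure ->]; exists nu; rewrite // mem_cat nupure.
- exact: add_subl.
- by apply: length_eq_colon => //; rewrite s1E -LE; apply: hh.
Qed.
End Products.

(** * Numerical polynomials *)

Section FiniteDifferences.
Implicit Types (f g : nat -> int) (D N b n k : nat).

Definition fdiff f n : int := f n.+1 - f n.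

(** Being eventually polynomial is phrased by differences, which behave well under shifts and
    partial sums and do not require naming the polynomial. *)
Definition evpoly f := exists D N, forall n, (N <= n)%N -> iter D fdiff f n = 0.

Lemma iter_fdiff_shift D f g b : (forall n, (b <= n)%N -> g n = f (n - b)%N) ->
  forall n, (b <= n)%N -> iter D fdiff g n = iter D fdiff f (n - b)%N.
Proof.
move=> h; elim: D => [|D IH] n bn //=; first exact: h.
by rewrite /fdiff !IH ?subSn // leqW.
Qed.

Lemma evpoly_shift f g b : (forall n, (b <= n)%N -> g n = f (n - b)%N) -> evpoly f -> evpoly g.
Proof.
move=> h [D [N hN]]; exists D, (b + N)%N => n bN.
rewrite (iter_fdiff_shift D h) ?hN //; lia.
Qed.

Lemma evpoly_fdiff f : evpoly (fdiff f) -> evpoly f.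
Proof. by move=> [D [N hN]]; exists D.+1, N => n /hN; rewrite iterSr. Qed.

Lemma evpoly_succ f : evpoly f -> evpoly (fun n => f n.+1).
Proof.
move=> [D [N hN]]; exists D, N => n Nn; rewrite -(hN n.+1 (leqW Nn)).
elim: D {hN} n {Nn} => //= D IH n; by rewrite /fdiff !IH.
Qed.

Lemma evpoly_sum f : evpoly f -> evpoly (fun n => \sum_(j < n.+1) f j).
Proof.
move=> ef; apply: evpoly_fdiff; apply: (evpoly_shift (b := 0%N) _ (evpoly_succ ef)) => n _.
by rewrite subn0 /fdiff big_ord_recr /= addrAC subrr add0r.
Qed.

Lemma evpoly_binomial f : evpoly f -> exists (a : seq int) N, forall n, (N <= n)%N ->
  f n = \sum_(k < size a) a`_k * ('C(n, k))%:Z.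
Proof.
move=> [D]; elim: D f => [|D IH] f [N hN].
  by exists [::], N => n /hN; rewrite big_ord0.
have [|a [M hM]] := IH (fdiff f); first by exists N => n /hN; rewrite iterSr.
(* Newton expansion: subtracting an antidifference of the expansion of [fdiff f] leaves a function
   constant from [M] on. *)
pose g n := f n - \sum_(k < size a) a`_k * ('C(n, k.+1))%:Z.
have gE n : g (M + n)%N = g M.
  elim: n => [|n IHn]; first by rewrite addn0.
  have /eqP := hM (M + n)%N (leq_addr _ _); rewrite -{}IHn /g /fdiff subr_eq addnS => /eqP->.
  have -> : \sum_(k < size a) a`_k * ('C((M + n).+1, k.+1))%:Z =
      \sum_(k < size a) a`_k * ('C(M + n, k))%:Z + \sum_(k < size a) a`_k * ('C(M + n, k.+1))%:Z.
    by rewrite -big_split; apply: eq_bigr => k _; rewrite binS PoszD mulrDr addrC.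
  by ring.
exists (g M :: a), M => n Mn; rewrite big_ord_recl /= bin0 mulr1 -(gE (n - M)%N) subnKC //.
by rewrite /g subrK.
Qed.

Fixpoint bin_poly k : {poly rat} :=
  if k is k'.+1 then k'.+1%:R^-1 *: (bin_poly k' * ('X - k'%:R%:P)) else 1.

Lemma bin_poly_nat k n : (bin_poly k).[n%:R] = ('C(n, k))%:R.
Proof.
elim: k => [|k IH] /=; first by rewrite hornerC bin0.
rewrite hornerZ hornerM IH hornerXsubC.
apply: (mulfI (x := k.+1%:R)); first by rewrite pnatr_eq0.
rewrite mulVKf ?pnatr_eq0 // -natrM mul_bin_left.
case: (leqP k n) => [kn|nk]; first by rewrite natrM natrB // mulrC.
by rewrite bin_small // mul0r muln0.
Qed.

(** Negation of the upper index; it gives integrality at negative integers, over which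
    [numerical_poly] also quantifies. *)
Lemma bin_poly_neg k n : (bin_poly k).[- n.+1%:R] = (-1) ^+ k * ('C(n + k, k))%:R.
Proof.
elim: k => [|k IH] /=; first by rewrite hornerC bin0 mulr1.
rewrite hornerZ hornerM IH hornerXsubC.
apply: (mulfI (x := k.+1%:R)); first by rewrite pnatr_eq0.
rewrite mulVKf ?pnatr_eq0 // mulrCA -natrM -mul_bin_diag addnS /= natrM exprS.
by rewrite -!addSn natrD; ring.
Qed.

Lemma bin_poly_int k (z : int) : (bin_poly k).[z%:~R] \is a Num.int.
Proof.
case: z => n; first by rewrite -pmulrn bin_poly_nat.
by rewrite NegzE mulrNz -pmulrn bin_poly_neg rpredM ?rpredX ?rpredN ?rpred1 ?rpred_nat.
Qed.

Lemma evpoly_poly f : evpoly f -> exists p : {poly rat},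
  (forall z : int, p.[z%:~R] \is a Num.int) /\
  exists N, forall n, (N <= n)%N -> (f n)%:~R = p.[n%:R].
Proof.
move=> /evpoly_binomial [a [N hN]]; exists (\sum_(k < size a) (a`_k)%:~R *: bin_poly k).
split=> [z|].
  rewrite horner_sum rpred_sum // => k _; rewrite hornerZ rpredM ?bin_poly_int //.
  exact: intr_int.
exists N => n /hN ->; rewrite horner_sum rmorph_sum; apply: eq_bigr => k _ /=.
by rewrite hornerZ bin_poly_nat intrM.
Qed.

(** For [b < c] only [k = b] contributes, for [b > c] nothing does, and for [b = c] the sum is a
    partial sum of [f] shifted by [c]. *)
Lemma evpoly_conv f b c : evpoly f ->
  evpoly (fun n => \sum_(k < n.+1 | minn k c == b) f (n - k)%N).
Proof.
move=> ef; case: (ltngtP b c) => [bc|cb|->].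
- apply: (evpoly_shift (f := f) (b := b)) => // n bn.
  rewrite (big_pred1 (Ordinal (bn : (b < n.+1)%N))) // => k /=.
  rewrite -val_eqE /= minnE; apply/eqP/eqP; lia.
- exists 0%N, 0%N => n _ /=; rewrite big_pred0 // => k; apply/eqP; lia.
- apply: (evpoly_shift (b := c) _ (evpoly_sum ef)) => n cn.
  rewrite (reindex_inj rev_ord_inj) /=.
  rewrite (big_ord_widen n.+1 (fun j => f j)) ?ltnS ?leq_subr //.
  apply: eq_big => [k|k _]; last by congr f; have := ltn_ord k; lia.
  have := ltn_ord k; lia.
Qed.

End FiniteDifferences.

(** * Degree bounds from growth *)

Section Growth.

Lemma lead_coef_gt0_bound (p : {poly rat}) : 0 < lead_coef p ->
  exists (e : rat) N, 0 < e /\ forall n, (N <= n)%N -> e <= p.[n%:R].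
Proof.
elim/poly_ind: p => [|p c IH]; first by rewrite lead_coef0 ltxx.
have [->|p0] := eqVneq p 0.
  rewrite mul0r add0r lead_coefC => c0; exists c, 0%N; split=> // n _.
  by rewrite hornerC.
rewrite lead_coefDl ?lead_coefMX; last first.
  rewrite size_mulX // (leq_ltn_trans (size_polyC_leq1 c)) // ltnS lt0n size_poly_eq0 //.
move=> /IH [e [N [e0 hN]]].
(* The second bound on [n] makes [e n + c] at least 1. *)
exists 1, (maxn N (Num.bound `|(1 - c) / e|)); split=> // n; rewrite geq_max => /andP[Nn bn].
rewrite hornerMXaddC -lerBlDr; apply: (@le_trans _ _ (e * n%:R)); last first.
  by rewrite ler_wpM2r // hN.
rewrite mulrC -ler_pdivrMr //; apply: le_trans (ler_norm _) (ltW _).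
by apply: lt_le_trans (archi_boundP (normr_ge0 _)) _; rewrite ler_nat.
Qed.

Lemma poly_growth (p : {poly rat}) C d N : (forall n, (N <= n)%N ->
    0 <= p.[n%:R] <= (C * n ^ d)%:R) -> (size p <= d.+1)%N.
Proof.
move=> h; rewrite leqNgt; apply/negP => sp.
have p0 : p != 0 by rewrite -size_poly_gt0 (leq_trans _ sp).
case: (ltrgtP (lead_coef p) 0) => [lp|lp|/eqP]; last by rewrite lead_coef_eq0 (negPf p0).
  have [|e [M [e0 hM]]] := @lead_coef_gt0_bound (- p).
    by rewrite lead_coefN oppr_gt0.
  have := hM _ (leq_maxr N M); have /andP[+ _] := h _ (leq_maxl N M).
  rewrite hornerN => h1 h2; have := lt_le_trans e0 h2; rewrite oppr_gt0 ltNge h1 //.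
(* If [p] had degree above [d], subtracting [C X^d] would keep its positive leading coefficient,
   against the upper bound. *)
pose q := p - C%:R *: 'X^d.
have sq : (size (- (C%:R *: 'X^d) : {poly rat}) < size p)%N.
  by rewrite size_polyN (leq_ltn_trans (size_scale_leq _ _)) // size_polyXn.
have [|e [M [e0 hM]]] := @lead_coef_gt0_bound q; first by rewrite /q lead_coefDl.
have := hM _ (leq_maxr N M); have /andP[_] := h _ (leq_maxl N M).
rewrite /q hornerD hornerN hornerZ hornerXn natrM natrX -subr_le0 => h1 h2.
by have := lt_le_trans e0 (le_trans h2 h1); rewrite ltxx.
Qed.

End Growth.

(** * Sums of products of one-variable functions *)

Section SumProd.
Variable r : nat.
Implicit Types (H : ('I_r -> nat) -> nat) (n : 'I_r -> nat).

(* The factors are [nat]-valued, so that a bound on the sum bounds each product. *)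
Inductive sumprod : (('I_r -> nat) -> nat) -> Prop :=
| SumProd0 H : (forall n, H n = 0%N) -> sumprod H
| SumProdD (f : 'I_r -> nat -> nat) H H' : (forall i, evpoly (fun k => (f i k)%:Z)) ->
    sumprod H -> (forall n, H' n = \prod_i f i (n i) + H n)%N -> sumprod H'.

Lemma sumprod_ext H H' : (forall n, H n = H' n) -> sumprod H -> sumprod H'.
Proof. by move=> e; have -> : H' = H by apply: functional_extensionality. Qed.

Lemma sumprod_add H H' : sumprod H -> sumprod H' -> sumprod (fun n => H n + H' n)%N.
Proof.
move=> sH sH'; elim: sH => [H0 h|f H1 H2 ef _ IH h].
  by apply: sumprod_ext sH' => n; rewrite h.
by apply: SumProdD ef IH _ => n; rewrite h addnA.
Qed.

Lemma sumprod_sum c (H : nat -> ('I_r -> nat) -> nat) : (forall b, sumprod (H b)) ->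
  sumprod (fun n => \sum_(b < c) H b n)%N.
Proof.
move=> h; elim: c => [|c IH]; first by apply: SumProd0 => n; rewrite big_ord0.
apply: sumprod_ext (sumprod_add IH (h c)) => n.
by rewrite big_ord_recr.
Qed.

(** Summing over the exponent of a variable labelled [g] alters only the factor at [g], by a
    convolution. *)
Lemma sumprod_conv g b c H : sumprod H -> sumprod (fun n =>
  \sum_(k < (n g).+1 | minn k c == b) H (fun i => n i - (g == i) * k))%N.
Proof.
elim=> [H0 h|f H1 H2 ef _ IH h]; first by apply: SumProd0 => n; rewrite big1.
pose f' i := if g == i then fun k => \sum_(j < k.+1 | minn j c == b) f i (k - j)%N else f i.
apply: (@SumProdD f' _ _ _ IH) => [i|n].
  rewrite /f'; case: eqP => [_|_]; last exact: ef.
  have := evpoly_conv b c (ef i).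
  by apply: (evpoly_shift (b := 0%N)) => k _; rewrite subn0 (big_morph Posz PoszD (erefl _)).
rewrite (eq_bigr _ (fun k _ => h _)) big_split /=; congr (_ + _)%N.
rewrite (bigD1 g) //= {1}/f' eqxx big_distrl /=; apply: eq_bigr => k _.
rewrite (bigD1 g) //= eqxx mul1n; congr (_ * _)%N; apply: eq_bigr => i.
by rewrite eq_sym /f' => /negPf ->; rewrite mul0n subn0.
Qed.

(** Induction on the variables. The first exponent [k] matters to [phi] only through [b = minn k c],
    so the sum splits over the [c + 1] values of [b]. *)
Lemma sumprod_mons (gs : seq 'I_r) phi c :
  (forall mu, size mu = size gs -> phi mu = phi (truncm c mu)) ->
  sumprod (fun n => \sum_(mu <- mons gs n) phi mu)%N.
Proof.
elim: gs phi => [|g gs IH] phi hphi.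
  have : sumprod (fun n => phi [::] * \prod_i (n i == 0%N))%N.
    elim: (phi _) => [|k IHk]; first exact: SumProd0.
    apply: (@SumProdD (fun _ k => (k == 0%N) : nat) _ _ _ IHk) => // _.
    by exists 0%N, 1%N => -[].
  apply: sumprod_ext => n /=; case: (boolP [forall i, _]) => [/forallP h|].
    by rewrite big_seq1 big1 ?muln1 // => i _; rewrite h.
  rewrite negb_forall => /existsP[i ni]; rewrite big_nil (bigD1 i) //= (negPf ni).
  by rewrite mul0n muln0.
pose H b n := (\sum_(mu <- mons gs n) phi (b :: mu))%N.
have tt mu : truncm c (truncm c mu) = truncm c mu.
  by rewrite /truncm -map_comp; apply: eq_map => k /=; lia.
have sH b : sumprod (H b).
  apply: IH => mu smu; rewrite hphi /= ?smu // [RHS]hphi /= ?size_truncm ?smu //.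
  by rewrite tt.
apply: sumprod_ext (sumprod_sum c.+1 (fun b => sumprod_conv g b c (sH b))) => n.
rewrite mons_cons big_flatten big_map -/(index_iota 0 (n g).+1) big_mkord.
rewrite (exchange_big_dep xpredT) //=; apply: eq_bigr => k _; rewrite big_map.
have kc : (minn k c < c.+1)%N by rewrite ltnS geq_minr.
rewrite (big_pred1 (Ordinal kc)) => [|b]; last exact: eq_sym.
apply: eq_big_seq => mu /memmonsP [smu _]; rewrite hphi /= ?smu // [RHS]hphi /= ?smu //.
by rewrite -minnA minnn.
Qed.

Definition mpoly_at (p : {poly rat}) (i : 'I_r) : {mpoly rat[r]} :=
  \sum_(k < size p) p`_k *: 'X_i ^+ k.

Lemma mpoly_atE p i v : (mpoly_at p i).@[v] = p.[v i].
Proof.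
rewrite /mpoly_at horner_coef raddf_sum; apply: eq_bigr => k _ /=.
by rewrite mevalZ rmorphXn /= mevalXU.
Qed.

Lemma msize_mpoly_at p i : (msize (mpoly_at p i) <= size p)%N.
Proof.
apply: leq_trans (mmeasure_sum _ _ _ _) _; apply/bigmax_leqP => k _.
apply: leq_trans (msizeZ_le _ _) _.
by rewrite mpolyXn msizeX mdegMn mdeg1 mul1n.
Qed.

(** The univariate product is the restriction to the diagonal, through which total degree is
    controlled. Since the [p i] are nonzero, degrees add on the univariate side. *)
Lemma msize_prod_mpoly_at (p : 'I_r -> {poly rat}) : (forall i, p i != 0) ->
  (msize (\prod_i mpoly_at (p i) i)%R <= size (\prod_i p i)%R)%N.
Proof.
move=> p0.
pose K (a : {mpoly rat[r]}) (b : {poly rat}) := (msize a <= size b)%N /\ b != 0.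
suff [] : K (\prod_i mpoly_at (p i) i) (\prod_i p i) by [].
apply: big_ind2; rewrite /K.
- by rewrite msize1 size_poly1 oner_eq0.
- move=> a b a' b' [ha b0] [ha' b'0]; split; last by rewrite mulf_neq0.
  have [->|a0] := eqVneq a 0; first by rewrite mul0r msize0.
  have [->|a'0] := eqVneq a' 0; first by rewrite mulr0 msize0.
  by rewrite msizeM // size_mul // -!subn1 leq_sub2r // leq_add.
- by move=> i _; split; [apply: msize_mpoly_at|apply: p0].
Qed.

Lemma sumprod_poly C d H : sumprod H -> (forall s, (H (fun=> s) <= C * s ^ d)%N) ->
  exists F : {mpoly rat[r]}, numerical_poly F /\ (msize F <= d.+1)%N /\
    exists N, forall n, (forall i, (N <= n i)%N) -> (H n)%:R = F.@[fun i => (n i)%:R].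
Proof.
elim=> [H0 h _|f H1 H2 ef _ IH h hC].
  exists 0; split; first by move=> z; rewrite meval0.
  by split; [rewrite msize0 | exists 0%N => n _; rewrite h meval0].
have [|F [nF [sF [N hN]]]] := IH.
  by move=> s; apply: leq_trans (hC s); rewrite h leq_addl.
have [p hp] := fin_all_exists (fun i => evpoly_poly (ef i)).
have [M hM] := fin_all_exists (fun i => proj2 (hp i)).
pose M0 := (\max_i M i)%N.
have fE n : (forall i, (M0 <= n i)%N) -> (\prod_i f i (n i))%:R = \prod_i (p i).[(n i)%:R] :> rat.
  move=> Mn; rewrite natr_prod; apply: eq_bigr => i _; rewrite -hM //.
  by apply: leq_trans (Mn i); apply: leq_bigmax.
exists (\prod_i mpoly_at (p i) i + F); split; [|split].
- move=> z; rewrite mevalD rpredD ?nF // rmorph_prod rpred_prod // => i _ /=.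
  by rewrite mpoly_atE; case: (hp i) => + _; apply.
- apply: leq_trans (msizeD_le _ _) _; rewrite geq_max sF andbT.
  (* If some [p i] vanishes, so does the product; otherwise its degree is read off on the diagonal,
     where it lies between 0 and [C s^d]. *)
  case: (boolP [forall i, p i != 0]) => [/forallP p0|]; last first.
    rewrite negb_forall => /existsP[i]; rewrite negbK => /eqP pi0.
    rewrite (bigD1 i) //= pi0 {1}/mpoly_at size_poly0 big_ord0 mul0r msize0 //.
  apply: leq_trans (msize_prod_mpoly_at p0) _.
  apply: (@poly_growth _ C d M0) => s Ms; rewrite horner_prod -(fE (fun=> s)) //.
  rewrite ler0n ler_nat; apply: leq_trans (hC s).
  by rewrite h leq_addr.
- exists (maxn M0 N) => n hn; rewrite h natrD mevalD; congr (_ + _).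
    rewrite fE => [|i]; last by apply: leq_trans (hn i); apply: leq_maxl.
    by rewrite rmorph_prod; apply: eq_bigr => i _ /=; rewrite mpoly_atE.
  by apply: hN => i; apply: leq_trans (hn i); apply: leq_maxr.
Qed.

End SumProd.

Theorem theorem5p3 (R : comNzRingType) (d r : nat) (I J : 'I_r -> R -> Prop) :
  noetherian R -> local_ring R -> krull_dim R d ->
  (forall i, is_ideal (I i)) -> (forall i, is_ideal (J i)) ->
  (forall i, sub_ideal (I i) (J i)) ->
  (forall i, exists l, length_eq (I i) (J i) l) ->
  exists F : {mpoly rat[r]},
    numerical_poly F /\ (msize F <= d.+1)%N /\
    exists N : nat, forall n : 'I_r -> nat, (forall i, (N <= n i)%N) ->
      exists l : nat,
        length_eq (ideal_prod_exp I n) (ideal_prod_exp J n) l /\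
        (l%:R : rat) = F.@[fun i => (n i)%:R].
Proof.
move=> noeR [m [mmax muniq]] [_ nch] iI iJ IJ lIJ.
have [gs [phi [c [hphi hlen]]]] := length_prod_exp noeR mmax muniq iI iJ IJ lIJ.
have [C hC] := diagonal_growth noeR mmax muniq iI iJ IJ lIJ nch.
have [|F [nF [sF [N hN]]]] := @sumprod_poly r C d _ (sumprod_mons hphi).
  by move=> s; apply: hC; case: (hlen (fun=> s)).
exists F; split=> //; split=> //; exists N => n Nn.
by exists (\sum_(mu <- mons gs n) phi mu)%N; split; [apply: hlen | apply: hN].
Qed.
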